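(* Let $n\ge 3$ and let $A$ and $B$ be parabolic subgroups of the braid group $B_n$. The double coset problem for the pair $(A,B)$ effectively reduces to the simultaneous conjugacy problem in $B_n$; that is, there is an algorithm, with access to a procedure solving the simultaneous conjugacy problem in $B_n$, which, given $g,g'\in B_n$, decides whether there are elements $a\in A$ and $b\in B$ such that $g'=agb$.
   Context: $B_n$ is the braid group on $n$ strands, with standard (Artin) generators $\sigma_1,\dotsc,\sigma_{n-1}$ and relations $\sigma_i\sigma_j=\sigma_j\sigma_i$ for $|i-j|\ge 2$ and $\sigma_i\sigma_{i+1}\sigma_i=\sigma_{i+1}\sigma_i\sigma_{i+1}$. Elements of $B_n$ are given to algorithms as words in the standard generators and their inverses. A subgroup of $B_n$ is standard parabolic if it is generated by a subset of $\{\sigma_1,\dotsc,\sigma_{n-1}\}$; it is parabolic if it is conjugate in $B_n$ to a standard parabolic subgroup. Each parabolic subgroup is assumed to be given by a standard parabolic subgroup together with a conjugating braid. Double coset problem for subgroups $A,B$ of a group $G$: given $(g,h)\in G^2$, decide whether $h\in AgB$. Simultaneous conjugacy problem in $G$: given two lists $(g_1,\dotsc,g_k)$ and $(h_1,\dotsc,h_k)$ of elements of $G$, for some $k$, decide whether there is $x\in G$ such that $x^{-1}g_ix=h_i$ for all $i=1,\dotsc,k$ (and, in a positive instance, a solution $x$ may be used). *)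

(* Defs.v *)
From HB Require Import structures.
From mathcomp Require Import all_boot.
From mathcomp Require Import boolp classical_sets.

Set Implicit Arguments.
Unset Strict Implicit.
Unset Printing Implicit Defensive.

Local Open Scope quotient_scope.
Local Open Scope group_scope.
Local Open Scope classical_set_scope.

(** * Braid groups *)

(* The letter [(i, false)] is the Artin generator sigma_(i+1), and [(i, true)]
   is its inverse: the n - 1 generators are numbered from 0. *)
Definition letter (n : nat) := ('I_n.-1 * bool)%type.
Definition word (n : nat) := seq (letter n).

Inductive braid_eq (n : nat) : word n -> word n -> Prop :=
| braid_eq_refl u : braid_eq u u
| braid_eq_sym u v : braid_eq u v -> braid_eq v u
| braid_eq_trans u v w : braid_eq u v -> braid_eq v w -> braid_eq u w
| braid_eq_cat u u' v v' :
    braid_eq u u' -> braid_eq v v' -> braid_eq (u ++ v) (u' ++ v')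
| braid_eq_cancel i b : braid_eq [:: (i, b); (i, ~~ b)] [::]
| braid_eq_far (i j : 'I_n.-1) : i.+1 < j ->
    braid_eq [:: (i, false); (j, false)] [:: (j, false); (i, false)]
| braid_eq_adjacent (i j : 'I_n.-1) : j = i.+1 :> nat ->
    braid_eq [:: (i, false); (j, false); (i, false)]
             [:: (j, false); (i, false); (j, false)].

Definition braid_rel n : rel (word n) := fun u v => `[< braid_eq u v >].

Lemma braid_rel_refl n : reflexive (@braid_rel n).
Proof. by move=> u; apply/asboolP; apply: braid_eq_refl. Qed.

Lemma braid_rel_sym n : symmetric (@braid_rel n).
Proof. by move=> u v; apply/asboolP/asboolP; apply: braid_eq_sym. Qed.

Lemma braid_rel_trans n : transitive (@braid_rel n).
Proof.
by move=> v u w /asboolP uv /asboolP vw; apply/asboolP; apply: braid_eq_trans uv vw.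
Qed.

Canonical braid_equiv n :=
  EquivRel (@braid_rel n) (@braid_rel_refl n) (@braid_rel_sym n)
    (@braid_rel_trans n).

Definition braid (n : nat) := {eq_quot (@braid_equiv n)}.

HB.instance Definition _ n := Choice.on (braid n).
HB.instance Definition _ n := EqQuotient.on (braid n).

Definition braid_of_word n (w : word n) : braid n := \pi_(braid n) w.

Lemma braid_of_wordP n (u v : word n) :
  braid_of_word u = braid_of_word v <-> braid_eq u v.
Proof.
split=> [/eqmodP/asboolP //|uv].
by apply/eqmodP/asboolP.
Qed.

Definition inv_word n (w : word n) : word n :=
  rev [seq (a.1, ~~ a.2) | a <- w].

Lemma inv_wordK n : involutive (@inv_word n).
Proof.
move=> w; rewrite /inv_word map_rev revK -map_comp -[RHS]map_id.
by apply: eq_map => -[i b] /=; rewrite negbK.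
Qed.

Lemma cat_inv_word n (w : word n) : braid_eq (w ++ inv_word w) [::].
Proof.
elim: w => [|[i b] w IHw]; first exact: braid_eq_refl.
rewrite /inv_word /= rev_cons -cats1 -/(inv_word w).
apply: braid_eq_trans (braid_eq_cancel i b).
rewrite -cat_cons -[(i, b) :: w]cat1s -[[:: (i, b); _]]cat1s -!catA.
apply: braid_eq_cat (braid_eq_refl _) _; rewrite catA.
by apply: braid_eq_cat IHw (braid_eq_refl _).
Qed.

Lemma inv_word_cat n (w : word n) : braid_eq (inv_word w ++ w) [::].
Proof. by have := cat_inv_word (inv_word w); rewrite inv_wordK. Qed.

Lemma inv_word_eq n (u v : word n) :
  braid_eq u v -> braid_eq (inv_word u) (inv_word v).
Proof.
move=> uv; apply: (@braid_eq_trans _ _ (inv_word u ++ (v ++ inv_word v))).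
  rewrite -{1}[inv_word u]cats0.
  apply: braid_eq_cat (braid_eq_refl _) _.
  exact/braid_eq_sym/cat_inv_word.
rewrite catA -{2}[inv_word v]cat0s.
apply: braid_eq_cat (braid_eq_refl _).
apply: braid_eq_trans (inv_word_cat u).
exact: braid_eq_cat (braid_eq_refl _) (braid_eq_sym uv).
Qed.

Definition braid_one n : braid n := braid_of_word [::].
Definition braid_mul n (x y : braid n) : braid n :=
  braid_of_word (repr x ++ repr y).
Definition braid_inv n (x : braid n) : braid n :=
  braid_of_word (inv_word (repr x)).

Lemma braid_mulE n (u v : word n) :
  braid_mul (braid_of_word u) (braid_of_word v) = braid_of_word (u ++ v).
Proof.
by apply/braid_of_wordP; apply: braid_eq_cat; apply/braid_of_wordP; apply: reprK.
Qed.

Lemma braid_invE n (u : word n) :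
  braid_inv (braid_of_word u) = braid_of_word (inv_word u).
Proof.
by apply/braid_of_wordP; apply: inv_word_eq; apply/braid_of_wordP; apply: reprK.
Qed.

Lemma braid_of_word_repr n (x : braid n) : braid_of_word (repr x) = x.
Proof. exact: reprK. Qed.

Lemma braid_mulA n : associative (@braid_mul n).
Proof.
move=> x y z.
rewrite -(braid_of_word_repr x) -(braid_of_word_repr y) -(braid_of_word_repr z).
by rewrite !braid_mulE catA.
Qed.

Lemma braid_mul1x n : left_id (@braid_one n) (@braid_mul n).
Proof. by move=> x; rewrite -(braid_of_word_repr x) braid_mulE. Qed.

Lemma braid_mulx1 n : right_id (@braid_one n) (@braid_mul n).
Proof. by move=> x; rewrite -(braid_of_word_repr x) braid_mulE cats0. Qed.

Lemma braid_mulVx n : left_inverse (@braid_one n) (@braid_inv n) (@braid_mul n).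
Proof.
move=> x; rewrite -(braid_of_word_repr x) braid_invE braid_mulE.
exact/braid_of_wordP/inv_word_cat.
Qed.

Lemma braid_mulxV n : right_inverse (@braid_one n) (@braid_inv n) (@braid_mul n).
Proof.
move=> x; rewrite -(braid_of_word_repr x) braid_invE braid_mulE.
exact/braid_of_wordP/cat_inv_word.
Qed.

HB.instance Definition _ n := isGroup.Build (braid n)
  (@braid_mulA n) (@braid_mul1x n) (@braid_mulx1 n)
  (@braid_mulVx n) (@braid_mulxV n).

Definition sigma n (i : 'I_n.-1) : braid n := braid_of_word [:: (i, false)].

(** * Parabolic subgroups *)

Definition generated (G : groupType) (S : set G) : set G :=
  smallest (fun H : set G => group_closed (mem H)) S.

Definition standard_parabolic n (A : set (braid n)) : Prop :=
  exists X : {set 'I_n.-1}, A = generated [set sigma i | i in [set` X]].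

Definition parabolic n (A : set (braid n)) : Prop :=
  exists (P : set (braid n)) (c : braid n),
    standard_parabolic P /\ A = [set x ^ c | x in P].

(** * A model of computation with an oracle *)

(* Jones's language WHILE, a Turing-complete language computing on binary
   trees, extended with a command that queries an oracle. *)

Inductive data : Type := Leaf | Node of data & data.

Fixpoint eq_data (d e : data) : bool :=
  match d, e with
  | Leaf, Leaf => true
  | Node d1 d2, Node e1 e2 => eq_data d1 e1 && eq_data d2 e2
  | _, _ => false
  end.

Definition encode_bool (b : bool) : data := if b then Node Leaf Leaf else Leaf.
Definition encode_nat (m : nat) : data := iter m (Node Leaf) Leaf.
Definition encode_option T (enc : T -> data) (o : option T) : data :=
  if o is Some x then Node Leaf (enc x) else Leaf.
Definition encode_seq T (enc : T -> data) (s : seq T) : data :=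
  foldr (fun x d => Node (enc x) d) Leaf s.
Definition encode_letter n (a : letter n) : data :=
  Node (encode_nat a.1) (encode_bool a.2).
Definition encode_word n (w : word n) : data := encode_seq (@encode_letter n) w.

Lemma encode_seq_inj T (enc : T -> data) :
  injective enc -> injective (encode_seq enc).
Proof.
move=> inj; elim=> [|x s IH] [|y t] //= [/inj -> /IH ->] //.
Qed.

Lemma encode_letter_inj n : injective (@encode_letter n).
Proof.
have natI : injective encode_nat.
  by elim=> [|m IH] [|m'] // [] /IH ->.
by move=> [i b] [j c] [] /= /natI /val_inj ->; case: b c => [] [].
Qed.

Lemma encode_word_inj n : injective (@encode_word n).
Proof. exact/encode_seq_inj/encode_letter_inj. Qed.

Inductive expr : Type :=
| Var of nat
| Const of data
| Pair of expr & expr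
| Head of expr
| Tail of expr
| Equal of expr & expr.

Inductive command : Type :=
| Assign of nat & expr
| Query of nat & expr
| Seq of command & command
| While of expr & command.

Definition store := nat -> data.

Definition update (s : store) (x : nat) (d : data) : store :=
  fun y => if y == x then d else s y.

Fixpoint eval (s : store) (e : expr) : data :=
  match e with
  | Var x => s x
  | Const d => d
  | Pair e1 e2 => Node (eval s e1) (eval s e2)
  | Head e1 => if eval s e1 is Node d _ then d else Leaf
  | Tail e1 => if eval s e1 is Node _ d then d else Leaf
  | Equal e1 e2 => encode_bool (eq_data (eval s e1) (eval s e2))
  end.

Inductive exec (oracle : data -> data) : command -> store -> store -> Prop :=
| exec_assign x e s : exec oracle (Assign x e) s (update s x (eval s e))
| exec_query x e s : exec oracle (Query x e) s (update s x (oracle (eval s e)))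
| exec_seq c1 c2 s1 s2 s3 :
    exec oracle c1 s1 s2 -> exec oracle c2 s2 s3 -> exec oracle (Seq c1 c2) s1 s3
| exec_while_stop e c s : eval s e = Leaf -> exec oracle (While e c) s s
| exec_while_step e c s1 s2 s3 :
    eval s1 e <> Leaf -> exec oracle c s1 s2 ->
    exec oracle (While e c) s2 s3 -> exec oracle (While e c) s1 s3.

Lemma exec_functional oracle p s s1 s2 :
  exec oracle p s s1 -> exec oracle p s s2 -> s1 = s2.
Proof.
move=> e1; elim: e1 s2 => {p s s1}.
- by move=> x e s s2 e2; inversion e2.
- by move=> x e s s2 e2; inversion e2.
- move=> c1 c2 s1 s2 s3 _ IH1 _ IH2 s4 e2; inversion e2; subst.
  by match goal with h : exec _ c1 s1 _ |- _ => apply: IH2; rewrite (IH1 _ h) end.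
- by move=> e c s h s2 e2; inversion e2.
- move=> e c s1 s2 s3 h _ IH1 _ IH2 s4 e2; inversion e2; subst; first by [].
  by match goal with h : exec _ c s1 _ |- _ => apply: IH2; rewrite (IH1 _ h) end.
Qed.

(* Input and output go through variable 0; all other variables start at [Leaf].
   By [exec_functional], a computation that halts has a single output. *)
Definition computes (oracle : data -> data) (p : command) (input output : data) :
    Prop :=
  exists2 s : store, exec oracle p (update (fun=> Leaf) 0 input) s
    & s 0 = output.

(** * The two decision problems *)

Definition simultaneous_conjugator n k (g h : k.-tuple (word n)) (x : braid n) :
    Prop :=
  forall i : 'I_k,
    (braid_of_word (tnth g i)) ^ x = braid_of_word (tnth h i).

(* The oracle answers [None] on negative instances, and on positive instances
   it returns some solution. Nothing is assumed about queries that do not encode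
   an instance, nor about which solution is returned. *)
Definition solves_simultaneous_conjugacy n (oracle : data -> data) : Prop :=
  forall (k : nat) (g h : k.-tuple (word n)),
  exists2 answer : option (word n),
    oracle (Node (encode_seq (@encode_word n) g) (encode_seq (@encode_word n) h))
      = encode_option (@encode_word n) answer
    & if answer is Some x then simultaneous_conjugator g h (braid_of_word x)
      else ~ exists x : braid n, simultaneous_conjugator g h x.

Lemma simultaneous_conjugacy_oracle_exists n :
  exists oracle, solves_simultaneous_conjugacy n oracle.
Proof.
pose E k (g h : k.-tuple (word n)) :=
  Node (encode_seq (@encode_word n) g) (encode_seq (@encode_word n) h).
pose S k (g h : k.-tuple (word n)) (answer : option (word n)) :=
  if answer is Some x then simultaneous_conjugator g h (braid_of_word x)
  else ~ exists x : braid n, simultaneous_conjugator g h x.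
have S_total k (g h : k.-tuple (word n)) : exists a, S k g h a.
  have [[x gxh]|no_x] := pselect (exists x : braid n, simultaneous_conjugator g h x).
    by exists (Some (repr x)); rewrite /S braid_of_word_repr.
  by exists None.
have answer d : exists e, forall k (g h : k.-tuple (word n)), d = E k g h ->
    exists2 a, e = encode_option (@encode_word n) a & S k g h a.
  have [[k [g [h ->]]]|no_gh] :=
      pselect (exists k (g h : k.-tuple (word n)), d = E k g h); last first.
    by exists Leaf => k g h e; case: no_gh; exists k, g, h.
  have [a Sa] := S_total k g h.
  exists (encode_option (@encode_word n) a) => k' g' h' [].
  move=> /(encode_seq_inj (@encode_word_inj n)) eg.
  move=> /(encode_seq_inj (@encode_word_inj n)) eh.
  have ek : k = k' by rewrite -(size_tuple g) eg size_tuple.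
  by subst k'; exists a => //; rewrite -(val_inj eg) -(val_inj eh).
have [oracle oracleP] := choice answer.
by exists oracle => k g h; apply: (oracleP _ k g h erefl).
Qed.

Definition in_double_coset (G : groupType) (A B : set G) (g h : G) : Prop :=
  exists a b : G, [/\ A a, B b & h = a * g * b].

Definition decides_double_coset n (A B : set (braid n))
    (oracle : data -> data) (p : command) : Prop :=
  forall g h : word n,
    computes oracle p (Node (encode_word g) (encode_word h))
      (encode_bool
        `[< in_double_coset A B (braid_of_word g) (braid_of_word h) >]).

(* The algorithm may depend on [A] and [B], but the same algorithm has to work
   with every procedure for the simultaneous conjugacy problem. *)
Definition double_coset_reduces_to_simultaneous_conjugacy n
    (A B : set (braid n)) : Prop :=
  exists p : command, forall oracle : data -> data,
    solves_simultaneous_conjugacy n oracle -> decides_double_coset A B oracle p.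

(* Main.v *)
(* After conjugation A and B are standard, A = <sigma_i : i in X> and
   B = <sigma_i : i in Y>.  If X or Y contains every generator there is only one
   double coset.  Otherwise, for a missing index j put
   A_j = <sigma_i : i <> j>; the full twists on the strands to the left and to
   the right of the cut j are central in A_j.

   The centralizer of these two twists is A_j Z with Z = <Delta^2> the centre of
   B_n.  For a positive y commuting with both, remove the longest prefix of y in
   A_j; if anything is left it starts with sigma_j, and Garside's lcm property
   forces r = Delta_(A_j)^-1 Delta to divide it.  Repeating this on the quotient
   with the mirror image of j splits off another such r', and r r' is Delta^2 up
   to an element of A_j, so induction on the length applies.  Since reduced
   fractions of positive braids are unique, the intersection of the A_j, j not in
   X, is A, and the twists of all these cuts have centralizer A Z.

   Hence g' is in A g B Z iff x^-1 g' t g'^-1 x = g t g^-1 and x^-1 s x = s have a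
   common solution x, with s and t running over the twists of A and of B.  To get
   rid of Z, fix one cut j of A and one cut k of B: the signed number of crossings
   in g between strands that start on different sides of j and end on different
   sides of k is constant on A g B and strictly increases under multiplication by
   Delta^2. *)
From Stdlib Require Import Setoid Morphisms.
Require Import Defs.
From mathcomp Require Import all_boot.
From mathcomp Require Import boolp classical_sets.
From mathcomp Require Import zify.

Set Implicit Arguments.
Unset Strict Implicit.
Unset Printing Implicit Defensive.

(** * The positive braid monoid *)

(** A solution of a conjugacy instance is only determined up to a centralizer, and every centralizer
    contains the centre, so a positive answer leaves a power of Delta^2 open. The exponent sum
    cannot fix it, as it varies in general inside A g B. Crossings between strands separated by a
    cut of A and by a cut of B are blind to A and B but see Delta^2: any two nonconstant
    two-colourings of the strands are separated by a common pair, and a full twist crosses every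
    pair. The same index is needed inside the centralizer argument. For each cut j one only gets x =
    a_j Delta^(2 m_j) with a_j in A_j, and the a_j have to be shown equal before the A_j can be
    intersected. Divisibility is studied on positive words, where length is an invariant and
    Garside's lemma yields cancellation and lcms. They embed in the braid group because an inverse
    letter is a positive word over the central Delta^2. Three strands are needed: on two strands
    both twists are trivial, so their centralizer is all of B_2 and not A_0 Z. *)

Definition far (i j : nat) := (i.+1 < j) || (j.+1 < i).
(* [i :: res i j] is the least common right multiple of the letters [i] and [j],
   so that [i :: res i j = j :: res j i] states all braid relations at once. *)
Definition res (i j : nat) : seq nat :=
  if i == j then [::] else if far i j then [:: j] else [:: j; i].

Inductive pstep : seq nat -> seq nat -> Prop :=
| pstep_head i j u : pstep (i :: res i j ++ u) (j :: res j i ++ u)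
| pstep_cons i u v : pstep u v -> pstep (i :: u) (i :: v).

(** Chains of single steps rather than a congruence closure: Garside's lemma is proved by induction
    along such a chain, looking only at the first letters of consecutive words. *)
Inductive peq : seq nat -> seq nat -> Prop :=
| peq_refl u : peq u u
| peq_step u v w : pstep u v -> peq v w -> peq u w.

Lemma pstep_sym u v : pstep u v -> pstep v u.
Proof. by elim=> *; constructor. Qed.

Lemma pstep_peq u v : pstep u v -> peq u v.
Proof. by move=> uv; apply: peq_step uv (peq_refl _). Qed.

Lemma peq_trans u v w : peq u v -> peq v w -> peq u w.
Proof. by elim=> // {}u v' {}v uv' _ IH /IH; apply: peq_step. Qed.

Lemma peq_sym u v : peq u v -> peq v u.
Proof.
elim=> [{}u|{}u v' {}v uv' _ IH]; first exact: peq_refl.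
by apply: peq_trans IH _; apply/pstep_peq/pstep_sym.
Qed.

#[local] Instance peq_equivalence : Equivalence peq.
Proof. by split; [exact: peq_refl | exact: peq_sym | exact: peq_trans]. Qed.

#[local] Hint Resolve peq_refl : core.

Lemma peq_cons i u v : peq u v -> peq (i :: u) (i :: v).
Proof.
elim=> [{}u|{}u v' {}v uv' _ IH]; first exact: peq_refl.
by apply: peq_step IH; constructor.
Qed.

Lemma pstep_catr u v w : pstep u v -> pstep (u ++ w) (v ++ w).
Proof.
elim=> [i j {}u|i {}u {}v _ IH] /=; last by constructor.
by rewrite -!catA; constructor.
Qed.

Lemma peq_cat u u' v v' : peq u u' -> peq v v' -> peq (u ++ v) (u' ++ v').
Proof.
move=> uu' vv'; apply: (@peq_trans _ (u' ++ v)); last first.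
  by elim: (u') => //= i w; apply: peq_cons.
elim: uu' => [w|{}u w {}u' uw _ IH]; first exact: peq_refl.
by apply: peq_step IH; apply: pstep_catr.
Qed.

#[local] Instance peq_cons_Proper :
  Proper (eq ==> peq ==> peq) (@cons nat).
Proof. by move=> i _ <- u v; apply: peq_cons. Qed.

#[local] Instance peq_cat_Proper :
  Proper (peq ==> peq ==> peq) (@cat nat).
Proof. by move=> u u' uu' v v'; apply: peq_cat. Qed.

Lemma size_res i j : size (res i j) = size (res j i).
Proof.
rewrite /res eq_sym; case: ifP => //= _.
by rewrite /far orbC; case: ifP.
Qed.

Lemma pstep_size u v : pstep u v -> size u = size v.
Proof. by elim=> [i j w|i {}u {}v _ IH] /=; rewrite ?size_cat ?IH // size_res. Qed.

Lemma peq_size u v : peq u v -> size u = size v.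
Proof. by elim=> // {}u w {}v /pstep_size-> _. Qed.

Lemma farC i j : far i j = far j i.
Proof. by rewrite /far orbC. Qed.

Lemma res_far i j : far i j -> (res i j = [:: j]) * (res j i = [:: i]).
Proof.
rewrite /res [far j i]farC [j == i]eq_sym; case: eqP => [->|_ ->] //.
by rewrite /far; lia.
Qed.

Lemma res_adj i j :
  ~~ far i j -> i != j -> (res i j = [:: j; i]) * (res j i = [:: i; j]).
Proof. by rewrite /res [far j i]farC [j == i]eq_sym => /negPf-> /negPf->. Qed.

Lemma res_id i : res i i = [::].
Proof. by rewrite /res eqxx. Qed.

Lemma peq_far i j u : far i j -> peq (i :: j :: u) (j :: i :: u).
Proof.
move=> ij; have := pstep_peq (pstep_head i j u).
by rewrite !(res_far ij).
Qed.

Lemma peq_adj i j u : ~~ far i j -> i != j ->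
  peq (i :: j :: i :: u) (j :: i :: j :: u).
Proof.
move=> ij nij; have := pstep_peq (pstep_head i j u).
by rewrite !(res_adj ij nij).
Qed.

(** The conclusion of Garside's lemma for [i :: u] and [j :: v]: both factor through the lcm of
    their first letters, with the same cofactor. *)
Definition common_residual (i j : nat) (u v : seq nat) :=
  exists w, peq u (res i j ++ w) /\ peq v (res j i ++ w).

Lemma pstep_common_residual i j u v :
  pstep (i :: u) (j :: v) -> common_residual i j u v.
Proof.
move=> st; inversion st as [i' j' w|]; subst; first by exists w.
by exists v; rewrite res_id /=; split=> //; apply: pstep_peq.
Qed.

(* Garside's argument: chains of relations are handled by transitivity of
   [common_residual], which only needs the result for shorter words. *)
Section CommonResidualTrans.
Variables (L : nat).
Hypothesis IH : forall i j u v, size u < L -> peq (i :: u) (j :: v) ->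
  common_residual i j u v.

Lemma cancel_small i u v : size u < L -> peq (i :: u) (i :: v) -> peq u v.
Proof.
by move=> uL /(IH uL) [w]; rewrite res_id /= => -[-> ->].
Qed.

Lemma far_small i j u v : far i j -> size u < L -> peq (i :: u) (j :: v) ->
  exists w, peq u (j :: w) /\ peq v (i :: w).
Proof.
by move=> ij uL /(IH uL) [w]; rewrite !(res_far ij); exists w.
Qed.

Lemma adj_small i j u v : ~~ far i j -> i != j -> size u < L ->
  peq (i :: u) (j :: v) ->
  exists w, peq u (j :: i :: w) /\ peq v (i :: j :: w).
Proof.
move=> ij nij uL /(IH uL) [w]; by rewrite !(res_adj ij nij); exists w.
Qed.

Lemma common_residual_id i u v : peq u v -> common_residual i i u v.
Proof. by exists v; rewrite res_id. Qed.

Lemma common_residual_sym i j u v : common_residual i j u v -> common_residual j i v u.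
Proof. by case=> w [uw vw]; exists w. Qed.

Lemma common_residual_farP i j u v : far i j ->
  (common_residual i j u v <-> exists w, peq u (j :: w) /\ peq v (i :: w)).
Proof. by move=> ij; rewrite /common_residual !(res_far ij). Qed.

Lemma common_residual_adjP i j u v : ~~ far i j -> i != j ->
  (common_residual i j u v <->
   exists w, peq u (j :: i :: w) /\ peq v (i :: j :: w)).
Proof.
by move=> ij nij; rewrite /common_residual !res_adj // 1?farC // eq_sym.
Qed.

Lemma common_residual_trans_far a b c u v x :
  a != b -> a != c -> c != b -> size u <= L -> far a c ->
  common_residual a c u x -> common_residual c b x v -> common_residual a b u v.
Proof.
move=> nab nac ncb uL ac /common_residual_farP - /(_ ac) [z1 [uz1 xz1]].
have zL : size z1 < L.
  by move: (peq_size uz1) => /=; lia.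
have [cb /common_residual_farP - /(_ cb)|cb /common_residual_adjP - /(_ cb ncb)] :=
  boolP (far c b) => -[z2 [xz2 vz2]]; rewrite xz1 in xz2.
  have [w [e1 e2]] := IH zL xz2.
  exists (c :: w); split.
    rewrite uz1 e1; have [ab|ab] := boolP (far a b).
      by rewrite (res_far ab) /= peq_far.
    rewrite (res_adj ab nab) /= (@peq_far c b) //.
    by rewrite (@peq_far c a) // farC.
  rewrite vz2 e2; have [ab|ab] := boolP (far a b).
    by rewrite (res_far ab) /= peq_far // farC.
  rewrite (res_adj ab nab) /= (@peq_far c a) 1?farC //.
  by rewrite (@peq_far c b).
have [ab|ab] := boolP (far a b).
  have [z [e1 e2]] := far_small ab zL xz2.
  have z2L : size z2 < L by move: (peq_size e2) (peq_size e1) => /=; lia.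
  have ca : far c a by rewrite farC.
  have [w [e3 e4]] := far_small ca z2L e2.
  apply/common_residual_farP=> //; exists (c :: b :: w).
  rewrite uz1 vz2 e1 e3 e4; split; first by rewrite peq_adj.
  by rewrite (@peq_far b a) 1?farC // (@peq_far c a).
(* Here [a], [b], [c] form a chain with [b] in the middle; the common multiple assembled below is
   the half twist on four strands, of length six. *)
have [z [e1 e2]] := adj_small ab nab zL xz2.
have zL' : size z2 < L by move: (peq_size e2) (peq_size e1) => /=; lia.
have ca : far c a by rewrite farC.
have [w [e3 e4]] := far_small ca zL' e2.
have zL'' : size z < L by move: (peq_size e1) => /=; lia.
have bc : ~~ far b c by rewrite farC.
have nbc : b != c by rewrite eq_sym.
have [y [e5 e6]] := adj_small bc nbc zL'' e4.
apply/common_residual_adjP=> //; exists (c :: b :: a :: y).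
have ba : ~~ far b a by rewrite farC.
have nba : b != a by rewrite eq_sym.
rewrite uz1 vz2 e1 e3 e5 e6; split.
  rewrite [in X in peq X _](@peq_far a c) // (@peq_adj c b) // (@peq_adj b a) //.
  by rewrite (@peq_far c a).
rewrite [in X in peq X _](@peq_adj b a) // [in X in peq X _](@peq_far c a) //.
rewrite [in X in peq X _](@peq_far a c y) //.
by rewrite (@peq_adj c b).
Qed.

Lemma common_residual_trans_adj a b c u v x :
  a != b -> a != c -> c != b -> size u <= L -> ~~ far a c -> ~~ far c b ->
  far a b ->
  common_residual a c u x -> common_residual c b x v -> common_residual a b u v.
Proof.
move=> nab nac ncb uL ac cb ab.
move=> /common_residual_adjP - /(_ ac nac) [z1 [uz1 xz1]].
move=> /common_residual_adjP - /(_ cb ncb) [z2 [xz2 vz2]].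
rewrite xz1 in xz2.
have zL : size (c :: z1) < L by move: (peq_size uz1) => /=; lia.
have [w [e1 e2]] := far_small ab zL xz2.
have zL1 : size z1 < L by move: zL => /=; lia.
have [y [e3 e4]] := adj_small cb ncb zL1 e1.
have zL2 : size z2 < L.
  by move: (peq_size e1) (peq_size e2) (peq_size e3) zL1 => /=; lia.
have ca : ~~ far c a by rewrite farC.
have nca : c != a by rewrite eq_sym.
have [y' [e5 e6]] := adj_small ca nca zL2 e2.
have e7 : peq (b :: y) (a :: y').
  apply: (@cancel_small c); last by rewrite -e4 e6.
  by move: (peq_size e3) zL1 => /=; lia.
have ba : far b a by rewrite farC.
have yL : size y < L by move: (peq_size e3) zL1 => /=; lia.
have [t [e8 e9]] := far_small ba yL e7.
(* Again the half twist on four strands, now with [c] as the middle letter of the chain. *)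
apply/common_residual_farP => //; exists (c :: b :: a :: c :: t).
have bc : ~~ far b c by rewrite farC.
have nbc : b != c by rewrite eq_sym.
rewrite uz1 vz2 e3 e5 e8 e9; split.
  rewrite [in X in peq X _](@peq_far a b) // [in X in peq X _](@peq_adj a c) //.
  by rewrite (@peq_adj c b).
rewrite [in X in peq X _](@peq_far b a) // [in X in peq X _](@peq_adj b c) //.
by rewrite (@peq_adj c a) // (@peq_far a b).
Qed.

Lemma cancel_prefix_small w u v :
  size (w ++ u) <= L -> peq (w ++ u) (w ++ v) -> peq u v.
Proof.
elim: w => //= i w IHw; rewrite size_cat => wL /cancel_small wuv.
by apply: IHw; [rewrite size_cat; lia | apply: wuv; rewrite size_cat].
Qed.

Lemma common_residual_size i j u v : common_residual i j u v -> size u = size v.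
Proof.
by case=> w [/peq_size-> /peq_size->]; rewrite !size_cat size_res.
Qed.

Lemma common_residual_trans a b c u v x :
  size u <= L ->
  common_residual a c u x -> common_residual c b x v -> common_residual a b u v.
Proof.
move=> uL uw xw.
have [eac|ac] := eqVneq a c.
  subst a; case: uw => w [uw xw1]; case: xw => [w' [xw' vw']].
  by rewrite res_id /= in uw xw1; exists w'; rewrite uw -xw1.
have [ecb|cb] := eqVneq c b.
  subst c; case: uw => w [uw xw1]; case: xw => [w' [xw' vw']].
  by rewrite res_id /= in xw' vw'; exists w; rewrite vw' -xw'.
have [eab|ab] := eqVneq a b.
  subst b; move: uL; rewrite (common_residual_size uw).
  case: uw => w [uw xw1]; case: xw => [w' [xw' vw']] xL.
  apply: common_residual_id; rewrite uw vw'; apply: peq_cat => //.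
  by apply: (@cancel_prefix_small (res c a)); rewrite -?(peq_size xw1) -?xw1.
have [fac|nfac] := boolP (far a c); first exact: common_residual_trans_far uw xw.
have [fcb|nfcb] := boolP (far c b).
  move: uL; rewrite (common_residual_size uw) (common_residual_size xw) => vL.
  apply: common_residual_sym.
  apply: common_residual_trans_far (common_residual_sym xw) (common_residual_sym uw);
    by rewrite 1?eq_sym // farC.
have fab : far a b by move: nfac nfcb ac cb ab; rewrite /far; lia.
exact: common_residual_trans_adj uw xw.
Qed.
End CommonResidualTrans.

(** Garside's lemma. The outer induction on the length supplies the result for shorter words, the
    inner one runs along the chain from [i :: u] to [j :: v]. The case [i = j] is left
    cancellation. *)
Lemma peq_common_residual i j u v :
  peq (i :: u) (j :: v) -> common_residual i j u v.
Proof.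
suff H L : forall i j u v, size u < L -> peq (i :: u) (j :: v) ->
    common_residual i j u v by apply: (H (size u).+1).
elim: L => // L IH {}i {}j {}u {}v; rewrite ltnS.
move eU: (i :: u) => U; move eV: (j :: v) => V => + UV.
elim: UV i u j v eU eV => {U V} [_ i u j v <-|U W V UW _ IHW i u j v eU eV uL].
  by case=> -> -> _; apply: common_residual_id.
subst U V; case: W UW IHW => [/pstep_size //|c x] ux IHW.
have {}ux := pstep_common_residual ux.
apply: (common_residual_trans IH uL ux).
by apply: IHW; rewrite -?(common_residual_size ux).
Qed.

Lemma peq_cancel_cons i u v : peq (i :: u) (i :: v) -> peq u v.
Proof. by move=> /peq_common_residual [w]; rewrite res_id /= => -[-> ->]. Qed.

Lemma peq_cancel_prefix w u v : peq (w ++ u) (w ++ v) -> peq u v.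
Proof. by elim: w => //= i w IH /peq_cancel_cons. Qed.

Lemma pstep_rev u v : pstep u v -> peq (rev u) (rev v).
Proof.
elim=> [i j w|i {}u {}v _ IH]; last by rewrite !rev_cons -!cats1 IH.
rewrite -!cat_cons !rev_cat; apply: peq_cat => //.
have [->|nij] := eqVneq i j; first by rewrite res_id.
have [ij|ij] := boolP (far i j).
  by rewrite !(res_far ij) /rev /= peq_far // farC.
by rewrite !(res_adj ij nij) /rev /= peq_adj.
Qed.

Lemma peq_rev u v : peq u v -> peq (rev u) (rev v).
Proof. by elim=> // {}u w {}v /pstep_rev-> _. Qed.

Lemma peq_cancel_suffix w u v : peq (u ++ w) (v ++ w) -> peq u v.
Proof.
move=> /peq_rev; rewrite !rev_cat => /peq_cancel_prefix /peq_rev.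
by rewrite !revK.
Qed.

Lemma pstep_support u v : pstep u v -> u =i v.
Proof.
elim=> [i j w|i {}u {}v _ IH] k; last by rewrite !inE IH.
have [->|nij] := eqVneq i j; first by rewrite res_id.
have [ij|ij] := boolP (far i j).
  by rewrite !(res_far ij) /= !inE orbCA.
rewrite !(res_adj ij nij) /= !inE; do ?case: eqP => //=.
Qed.

Lemma peq_support u v : peq u v -> u =i v.
Proof. by elim=> // {}u w {}v /pstep_support uw _ IH k; rewrite uw IH. Qed.

(** * Half twists *)

(** The half twist of the strands in positions [a] to [a + k], that is, Garside's element for the
    [k] letters from [a] on. *)
Fixpoint Delta a k : seq nat :=
  if k is k'.+1 then iota a k ++ Delta a k' else [::].

Lemma all_Delta a k : all (fun i => a <= i < a + k) (Delta a k).
Proof.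
elim: k => // k IH; rewrite -[Delta _ _]/(iota a k.+1 ++ Delta a k) all_cat.
apply/andP; split; first by apply/allP => i; rewrite mem_iota.
by apply: sub_all IH => i; lia.
Qed.

Lemma peq_far_word i u v : all (far i) u -> peq (i :: u ++ v) (u ++ i :: v).
Proof.
elim: u => //= j u IH /andP[ij /IH iu].
by rewrite peq_far // iu.
Qed.

Lemma iota_shift a k i u : a <= i -> i.+1 < a + k ->
  peq (iota a k ++ i :: u) (i.+1 :: iota a k ++ u).
Proof.
elim: k a => [|k IH] a; first by lia.
move=> ai ik; have [eai|nai] := eqVneq a i; last first.
  by rewrite /= IH; [rewrite peq_far // /far; lia | lia | lia].
subst a; case: k IH ik => [|k] _ ik; first by lia.
have far_a : all (far i) (iota i.+2 k).
  by apply/allP => j; rewrite mem_iota /far; lia.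
have nfar : ~~ far i.+1 i by rewrite /far; lia.
have na : i.+1 != i by lia.
rewrite /= -(@peq_far_word i) //.
by rewrite (@peq_adj i.+1) // -(@peq_far_word i).
Qed.

Lemma rev_iota_shift a k i u : a <= i -> i.+1 < a + k ->
  peq (rev (iota a k) ++ i.+1 :: u) (i :: rev (iota a k) ++ u).
Proof.
move=> ai ik; have := peq_rev (iota_shift [::] ai ik).
rewrite rev_cat rev_cons cats0 rev_cons /= -[rcons (rev _) _]cats1 => e.
by rewrite -cat1s catA -e.
Qed.

Lemma rev_iotaS a k : rev (iota a k.+1) = a + k :: rev (iota a k).
Proof. by rewrite -addn1 iotaD rev_cat. Qed.

Lemma DeltaS a k : Delta a k.+1 = iota a k.+1 ++ Delta a k.
Proof. by []. Qed.

Lemma far_Delta a k i : a + k < i -> all (far i) (Delta a k).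
Proof. by move=> ki; apply: sub_all (all_Delta a k) => j; rewrite /far; lia. Qed.

Lemma DeltaSr a k : peq (Delta a k.+1) (Delta a k ++ rev (iota a k.+1)).
Proof.
elim: k => // k IH.
rewrite [Delta a k.+2]DeltaS [in X in peq X _]IH (rev_iotaS _ k.+1) DeltaS.
rewrite -{1}[k.+2]addn1 iotaD -!catA.
by rewrite [iota _ 1]/= cat1s (@peq_far_word (a + k.+1)) //; apply: far_Delta; lia.
Qed.

(** The defining factorization carries every letter but the lowest to a shorter half twist, lowering
    it by one. The lowest letter is treated with the mirrored factorization [DeltaSr]. *)
Lemma Delta_conj a k i j : i + j.+1 = k ->
  peq (a + i :: Delta a k) (rcons (Delta a k) (a + j)).
Proof.
rewrite -cats1; elim: k i j => [|k IH] i j; first by lia.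
case: i => [|i] eij; last first.
  rewrite DeltaS addnS -iota_shift; try lia.
  by rewrite (IH i j) ?catA //; lia.
have {eij}->: j = k by lia.
case: k IH => [|k] IH; first by rewrite addn0.
rewrite (DeltaSr a k.+1) -cat_cons (IH 0 k) // -!catA addnS.
rewrite rev_iota_shift ?cats0 //=; lia.
Qed.

Lemma Delta_divl a k i : i < k -> exists w, peq (Delta a k) (a + i :: w).
Proof.
elim: k i => [|k IH] i; first by rewrite ltn0.
case: i => [|i] ik; first by exists (iota a.+1 k ++ Delta a k); rewrite addn0.
have [w e] := IH i ik; exists (iota a k.+1 ++ w).
by rewrite DeltaS e addnS iota_shift //; lia.
Qed.

Lemma far_word_divl i u y z : all (far i) u ->
  peq (u ++ y) (i :: z) -> exists w, peq y (i :: w).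
Proof.
elim: u z => [|j u IH] z /=; first by exists z.
case/andP => ij iu /peq_common_residual; rewrite common_residual_farP 1?farC //.
by case=> w [/(IH _ iu)].
Qed.

(** With [DeltaSr], this makes [Delta a k.+1] the lcm of [Delta a k] and the letter [a + k]. The
    letter passes the far prefix of [Delta a k], meets its one neighbour, and the same situation
    recurs one letter lower. *)
Lemma Delta_succ_divl a k y z : peq (Delta a k ++ y) (a + k :: z) ->
  exists w, peq y (rev (iota a k.+1) ++ w).
Proof.
elim: k y z => [|k IH] y z; first by rewrite addn0; exists z.
rewrite DeltaS -{1}[k.+1]addn1 iotaD -!catA.
have far_iota : all (far (a + k.+1)) (iota a k).
  by apply/allP => j; rewrite mem_iota /far; lia.
have nf : ~~ far (a + k) (a + k.+1) by rewrite /far; lia.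
have nk : a + k != a + k.+1 by lia.
case/(far_word_divl far_iota) => {}z /= /peq_common_residual.
move=> /common_residual_adjP - /(_ nf nk) [w [e _]].
have far_D : all (far (a + k.+1)) (Delta a k) by apply: far_Delta; lia.
have [y' ey] := far_word_divl far_D e.
rewrite ey -(peq_far_word _ far_D) in e.
have [w' ew'] := IH _ _ (peq_cancel_cons e).
by exists w'; rewrite ey ew' (rev_iotaS a k.+1).
Qed.

Lemma Delta_least a k y :
  (forall i, i < k -> exists w, peq y (a + i :: w)) ->
  exists w, peq y (Delta a k ++ w).
Proof.
elim: k => [|k IH] yk; first by exists y.
have [|w ew] := IH; first by move=> i ik; apply: yk; lia.
have [z ez] := yk k (ltnSn k); rewrite ew in ez.
have [w' ew'] := Delta_succ_divl ez.
by exists w'; rewrite DeltaSr -catA ew ew'.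
Qed.

Definition Delta2 N := Delta 0 N ++ Delta 0 N.

Lemma Delta2_central N i : i < N -> peq (i :: Delta2 N) (rcons (Delta2 N) i).
Proof.
move=> iN; have e1 := @Delta_conj 0 N i (N - i.+1) ltac:(lia).
have e2 := @Delta_conj 0 N (N - i.+1) i ltac:(lia).
rewrite /Delta2 -cat_cons e1 cat_rcons.
by rewrite e2 rcons_cat.
Qed.

Lemma Delta2_central_word N u : all (gtn N) u ->
  peq (u ++ Delta2 N) (Delta2 N ++ u).
Proof.
elim: u => [|i u IH] /=; first by rewrite cats0.
case/andP => iN /IH ->; rewrite -cat_cons Delta2_central //.
by rewrite cat_rcons.
Qed.

Local Open Scope group_scope.

(** * Positive braids inside the braid group *)

(** Positive words use plain naturals so that indices can be shifted and mirrored freely. Letters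
    out of range are dropped, hence the bounds [all (gtn N)] throughout. *)
Definition pos_word n (u : seq nat) : word n :=
  pmap (fun k => omap (fun i => (i, false)) (insub k)) u.

Definition ev n (u : seq nat) : braid n := braid_of_word (pos_word n u).

Lemma braid_of_word_cat n (u v : word n) :
  braid_of_word (u ++ v) = braid_of_word u * braid_of_word v.
Proof. by rewrite -braid_mulE. Qed.

Lemma braid_of_word_inv n (u : word n) :
  braid_of_word (inv_word u) = (braid_of_word u)^-1.
Proof. by rewrite -braid_invE. Qed.

Lemma ev_cat n u v : ev n (u ++ v) = ev n u * ev n v.
Proof. by rewrite /ev /pos_word pmap_cat braid_of_word_cat. Qed.

Lemma ev_nil n : ev n [::] = 1.
Proof. by []. Qed.

Lemma ev_cons n i u : ev n (i :: u) = ev n [:: i] * ev n u.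
Proof. by rewrite -cat1s ev_cat. Qed.

Lemma pos_word_ord n (i : 'I_n.-1) : pos_word n [:: val i] = [:: (i, false)].
Proof. by rewrite /pos_word /= valK. Qed.

Lemma ev_ord n (i : 'I_n.-1) : ev n [:: val i] = sigma i.
Proof. by rewrite /ev pos_word_ord. Qed.

Lemma ev_far n i j : far i j -> i < n.-1 -> j < n.-1 ->
  ev n [:: i; j] = ev n [:: j; i].
Proof.
move=> ij iN jN; rewrite !(ev_cons _ _ [:: _]).
rewrite -[i]/(val (Ordinal iN)) -[j]/(val (Ordinal jN)) !ev_ord.
have [ij'|ji] := orP ij; last symmetry.
all: rewrite /sigma -!braid_of_word_cat; apply/braid_of_wordP.
all: exact: braid_eq_far.
Qed.

Lemma ev_adj n i j : ~~ far i j -> i != j -> i < n.-1 -> j < n.-1 ->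
  ev n [:: i; j; i] = ev n [:: j; i; j].
Proof.
move=> ij nij iN jN; rewrite !(ev_cons _ _ [:: _; _]) !(ev_cons _ _ [:: _]).
rewrite -[i]/(val (Ordinal iN)) -[j]/(val (Ordinal jN)) !ev_ord.
have ji : j = i.+1 \/ i = j.+1 by move: ij nij; rewrite /far; lia.
case: ji => ji; last symmetry.
all: rewrite /sigma -!braid_of_word_cat; apply/braid_of_wordP.
all: exact: braid_eq_adjacent.
Qed.

Lemma ev_pstep n u v : pstep u v -> all (gtn n.-1) u -> ev n u = ev n v.
Proof.
elim=> [i j w|i {}u {}v _ IH] /=; last first.
  by case/andP=> _ /IH uv; rewrite ev_cons uv -ev_cons.
rewrite all_cat -!cat_cons !ev_cat => /and3P[iN rN _]; congr (_ * _); move: rN.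
have [->|nij] := eqVneq i j; first by rewrite res_id.
have [ij|ij] := boolP (far i j).
  by rewrite !(res_far ij) /= andbT => jN; apply: ev_far.
by rewrite !(res_adj ij nij) /= => /andP[jN _]; apply: ev_adj.
Qed.

Lemma all_peq (p : pred nat) u v : peq u v -> all p u = all p v.
Proof. by move=> /peq_support uv; apply: eq_all_r. Qed.

Lemma ev_peq n u v : peq u v -> all (gtn n.-1) u -> ev n u = ev n v.
Proof.
elim=> // {}u w {}v uw _ IH uN.
by rewrite (ev_pstep uw uN) IH // -(all_peq _ (pstep_peq uw)).
Qed.

Section PositiveEmbedding.
Variables (n : nat) (cs : nat -> seq nat).
Let N := n.-1.
Hypothesis csP : forall i, i < N -> [/\ all (gtn N) (cs i),
  peq (i :: cs i) (Delta2 N) & peq (rcons (cs i) i) (Delta2 N)].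

(* [w] equals [num w] times [Delta^(-2 den w)]. *)
Definition num (w : word n) : seq nat :=
  flatten
    [seq if a.2 then cs (val a.1) else [:: val a.1] | a : letter n <- w].
Definition den (w : word n) : nat := count snd w.
Definition Dpow k := flatten (nseq k (Delta2 N)).

Lemma num_cat u v : num (u ++ v) = num u ++ num v.
Proof. by rewrite /num map_cat flatten_cat. Qed.

Lemma den_cat u v : den (u ++ v) = den u + den v.
Proof. exact: count_cat. Qed.

Lemma DpowD k l : Dpow (k + l) = Dpow k ++ Dpow l.
Proof. by rewrite /Dpow nseqD flatten_cat. Qed.

Lemma DpowC k l : Dpow k ++ Dpow l = Dpow l ++ Dpow k.
Proof. by rewrite -!DpowD addnC. Qed.

Lemma all_num w : all (gtn N) (num w).
Proof.
elim: w => //= -[i []] w IH; rewrite /num /= -/(num w) ?all_cat IH andbT //.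
by have [] := csP (ltn_ord i).
Qed.

Lemma Dpow_central k w : all (gtn N) w -> peq (w ++ Dpow k) (Dpow k ++ w).
Proof.
move=> wN; elim: k => [|k IH]; first by rewrite cats0.
rewrite -addn1 DpowD {1}DpowC catA -catA /Dpow /= cats0.
rewrite catA Delta2_central_word // -catA IH catA.
by have := DpowC 1 k; rewrite /Dpow /= cats0 => <-.
Qed.

(** Equality of two fractions over powers of Delta^2, multiplied out. Cancellation of positive words
    makes this relation transitive, centrality of Delta^2 makes it a congruence, and [csP] settles
    the cancelling pairs. *)
Lemma braid_eq_num u v : braid_eq u v ->
  peq (num u ++ Dpow (den v)) (num v ++ Dpow (den u)).
Proof.
elim=> {u v} [u|u v _ IH|u v w _ IH1 _ IH2|u u' v v' _ IH1 _ IH2|i b|i j ij|i j ij].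
- by [].
- by rewrite IH.
- apply: (@peq_cancel_suffix (Dpow (den v))).
  have swap x k l : (x ++ Dpow k) ++ Dpow l = (x ++ Dpow l) ++ Dpow k.
    by rewrite -!catA DpowC.
  by rewrite (swap (num u)) IH1 (swap (num v)) IH2 (swap (num w)).
- have swap x w k l : peq ((x ++ num w) ++ Dpow (k + l))
      ((x ++ Dpow k) ++ (num w ++ Dpow l)).
    rewrite DpowD -!catA; apply: peq_cat => //; rewrite !catA.
    by apply: peq_cat => //; apply: Dpow_central (all_num w).
  by rewrite !num_cat !den_cat swap IH1 IH2 -swap.
- have [_ e1 e2] := csP (ltn_ord i).
  by case: b; rewrite /num /den /= ?cats0 // /Dpow /= cats0 // -cats1 in e2 *.
- by rewrite /num /den /= peq_far // /far ij.
- rewrite /num /den /= peq_adj // ?ij /far; lia.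
Qed.

Lemma num_pos_word u : all (gtn N) u -> num (pos_word n u) = u.
Proof.
elim: u => //= i u IH /andP[iN /IH e].
by rewrite /pos_word /= insubT /= -[in RHS]e.
Qed.

Lemma den_pos_word u : den (pos_word n u) = 0.
Proof. by elim: u => //= i u IH; rewrite /pos_word /=; case: insub. Qed.

Lemma ev_inj_aux u v : all (gtn N) u -> all (gtn N) v ->
  ev n u = ev n v -> peq u v.
Proof.
move=> uN vN /braid_of_wordP /braid_eq_num.
by rewrite !den_pos_word !num_pos_word // /Dpow /= !cats0.
Qed.
End PositiveEmbedding.

Lemma Delta_cofactor N : exists cs : nat -> seq nat, forall i, i < N ->
  [/\ all (gtn N) (cs i), peq (i :: cs i) (Delta2 N) &
      peq (rcons (cs i) i) (Delta2 N)].
Proof.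
suff H i : exists w, i < N -> [/\ all (gtn N) w, peq (i :: w) (Delta2 N) &
      peq (rcons w i) (Delta2 N)] 
    by have [cs csP] := choice H; exists cs.
have [iN|] := boolP (i < N); last by exists [::].
have [w ew] := Delta_divl 0 iN; exists (w ++ Delta 0 N) => _.
have e1 : peq (i :: w ++ Delta 0 N) (Delta2 N) by rewrite /Delta2 ew.
have D_N : all (gtn N) (Delta 0 N) by apply: sub_all (all_Delta 0 N) => j /=; lia.
split=> //.
  rewrite all_cat D_N andbT.
  by move: D_N; rewrite (all_peq _ ew) /= => /andP[].
(* With c the left cofactor, i c i = Delta^2 i = i Delta^2; cancelling the first letter shows that c
   is a right cofactor as well. *)
apply: (@peq_cancel_cons i); rewrite -rcons_cons -cats1 e1.
by rewrite Delta2_central // cats1.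
Qed.

Lemma ev_inj n u v : all (gtn n.-1) u -> all (gtn n.-1) v ->
  ev n u = ev n v -> peq u v.
Proof. by have [cs csP] := Delta_cofactor n.-1; apply: (ev_inj_aux csP). Qed.

(** * Divisibility *)

Section Positive.
Variable n : nat.
Let N := n.-1.
Implicit Types (x y z f g : braid n) (Y : pred nat) (u v w : seq nat).

Definition positive x := exists2 u, all (gtn N) u & x = ev n u.
Definition dvd x y := positive (x^-1 * y).

Lemma positive_ev u : all (gtn N) u -> positive (ev n u).
Proof. by exists u. Qed.

Lemma positive1 : positive 1.
Proof. by exists [::]. Qed.

Lemma positiveM x y : positive x -> positive y -> positive (x * y).
Proof.
by case=> u uN -> [v vN ->]; exists (u ++ v); rewrite ?all_cat ?uN // ev_cat.
Qed.

Lemma dvd_refl x : dvd x x.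
Proof. by rewrite /dvd mulVg; apply: positive1. Qed.

Lemma dvd_mulr x y : positive y -> dvd x (x * y).
Proof. by rewrite /dvd mulKg. Qed.

Lemma dvd_trans y x z : dvd x y -> dvd y z -> dvd x z.
Proof.
by move=> xy yz; have := positiveM xy yz; rewrite -mulgA mulVKg.
Qed.

Lemma dvd_mulrl x y z : dvd x y -> positive z -> dvd x (y * z).
Proof. by move=> xy pz; apply: dvd_trans xy (dvd_mulr _ pz). Qed.

Lemma dvd_mul2l x y z : dvd (x * y) (x * z) = dvd y z.
Proof. by rewrite /dvd invgM -mulgA mulKg. Qed.

Lemma dvd_mull x y z : dvd (x * y) z = dvd y (x^-1 * z).
Proof. by rewrite /dvd invgM mulgA. Qed.

Lemma dvd1 x : dvd 1 x = positive x.
Proof. by rewrite /dvd invg1 mul1g. Qed.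

Lemma dvd_positive x y : positive x -> dvd x y -> positive y.
Proof. by move=> px /(positiveM px); rewrite mulVKg. Qed.

Lemma dvd_evP u v : all (gtn N) u -> all (gtn N) v ->
  dvd (ev n u) (ev n v) <-> exists w, peq v (u ++ w).
Proof.
move=> uN vN; split=> [[w wN e]|[w e]].
  exists w; apply: (@ev_inj n) => //; first by rewrite all_cat uN.
  by rewrite ev_cat -e mulVKg.
have := vN; rewrite (all_peq _ e) all_cat => /andP[_ wN].
by rewrite (ev_peq e vN) ev_cat; apply/dvd_mulr/positive_ev.
Qed.

Lemma dvd_genP i v : i < N -> all (gtn N) v ->
  dvd (ev n [:: i]) (ev n v) <-> exists w, peq v (i :: w).
Proof. by move=> iN vN; rewrite dvd_evP //= iN. Qed.

Lemma dvd_res i j y : i < N -> j < N ->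
  dvd (ev n [:: i]) y -> dvd (ev n [:: j]) y -> dvd (ev n (i :: res i j)) y.
Proof.
move=> iN jN iy; have [u uN ey] : positive y.
  by apply: dvd_positive iy; exists [:: i] => //=; rewrite iN.
subst y; move: iy; rewrite !dvd_genP // => -[v ev] [w ew].
rewrite ev in ew; have [z [ez _]] := peq_common_residual ew.
have ez' : peq u ((i :: res i j) ++ z) by rewrite ev ez.
apply/dvd_evP => //; last by exists z.
by move: uN; rewrite (all_peq _ ez') all_cat => /andP[].
Qed.

Lemma ev_res_sym i j : i < N -> j < N ->
  ev n (i :: res i j) = ev n (j :: res j i).
Proof.
move=> iN jN; apply: ev_peq; first by have /= := pstep_peq (pstep_head i j [::]);
  rewrite !cats0.
by rewrite /= /res; do !case: ifP => _ /=; rewrite ?iN ?jN.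
Qed.

Lemma all_res (p : pred nat) i j : p i -> p j -> all p (res i j).
Proof. by move=> pi pj; rewrite /res; do !case: ifP => _ /=; rewrite ?pi ?pj. Qed.

Definition is_lcm f g y :=
  [/\ dvd f y, dvd g y & forall z, dvd f z -> dvd g z -> dvd y z].

Lemma positiveP x : positive x ->
  x = 1 \/ exists i y, [/\ i < N, positive y & x = ev n [:: i] * y].
Proof.
case=> -[|i u] /=; first by left.
case/andP=> iN uN ->; right; exists i, (ev n u).
by split; [|exists u|rewrite -ev_cons].
Qed.

(** The lcm is tiled from smaller ones, by induction on the length of the given common multiple [y].
    For f = i f' and g = j g' these are the lcms of f' with [res i j], of g' with [res j i], and of
    the two cofactors left over. Each has a common multiple obtained from [y] by removing at least
    one letter. *)
Lemma lcm_exists f g y : positive f -> positive g -> dvd f y -> dvd g y ->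
  exists m, is_lcm f g m.
Proof.
move=> pf pg fy gy; have [u uN ey] := dvd_positive pf fy.
have [m] := ubnP (size u).
elim: m => // m IH in f g y pf pg fy gy u uN ey *; rewrite ltnS => um.
have [->|[i [f' [iN pf' ef]]]] := positiveP pf.
  by exists g; split=> //; [rewrite dvd1|exact: dvd_refl].
have [->|[j [g' [jN pg' eg]]]] := positiveP pg.
  by exists f; split=> //; [exact: dvd_refl|rewrite dvd1].
subst f g; have pi k : k < N -> positive (ev n [:: k]).
  by move=> kN; exists [:: k] => //=; rewrite kN.
have gen_dvd k h z : positive h -> dvd (ev n [:: k] * h) z -> dvd (ev n [:: k]) z.
  by move=> ph; apply/dvd_trans/dvd_mulr.
have small k h : k < N -> dvd (ev n [:: k] * h) y -> positive h ->
    exists2 v, all (gtn N) v & (ev n [:: k])^-1 * y = ev n v /\ size v < m.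
  move=> kN khy ph; have [v vN e] := gen_dvd _ _ _ ph khy.
  exists v => //; split=> //.
  have /peq_size /= e2 : peq u (k :: v).
    by apply: (@ev_inj n); rewrite /= ?kN // -ey ev_cons -e mulVKg.
  by rewrite e2 in um.
have resd k l z : k < N -> l < N -> dvd (ev n [:: k]) z -> dvd (ev n [:: l]) z ->
    dvd (ev n (res k l)) ((ev n [:: k])^-1 * z).
  by move=> kN lN kz lz; rewrite -dvd_mull -ev_cons; apply: dvd_res.
have pres k l : k < N -> l < N -> positive (ev n (res k l)).
  by move=> kN lN; apply/positive_ev/all_res.
have [iy jy] := (gen_dvd _ _ _ pf' fy, gen_dvd _ _ _ pg' gy).
have [v1 v1N [ev1 v1m]] := small _ _ iN fy pf'.
have [v2 v2N [ev2 v2m]] := small _ _ jN gy pg'.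
have [L1 [fL1 rL1 L1_least]] : exists L1, is_lcm f' (ev n (res i j)) L1.
  apply: (IH _ _ _ _ _ _ _ v1 v1N ev1 v1m) => //; first exact: pres.
    by rewrite -dvd_mull.
  exact: resd.
have [L2 [gL2 rL2 L2_least]] : exists L2, is_lcm g' (ev n (res j i)) L2.
  apply: (IH _ _ _ _ _ _ _ v2 v2N ev2 v2m) => //; first exact: pres.
    by rewrite -dvd_mull.
  exact: resd.
(* [M] is the lcm of the two first letters; [h] and [k] are what has to follow it to reach a
   multiple of each factor. *)
set M := ev n (i :: res i j).
have eM : M = ev n (j :: res j i) by apply: ev_res_sym.
have [h eh] : exists h, h = (ev n (res i j))^-1 * L1 by eexists.
have [k ek] : exists k, k = (ev n (res j i))^-1 * L2 by eexists.
have ML1 : M * h = ev n [:: i] * L1 by rewrite eh /M ev_cons -mulgA mulVKg.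
have ML2 : M * k = ev n [:: j] * L2 by rewrite ek eM ev_cons -mulgA mulVKg.
have ph : positive h by rewrite eh.
have pk : positive k by rewrite ek.
have hM z : dvd (ev n [:: i] * f') z -> dvd (ev n [:: j] * g') z -> dvd h (M^-1 * z).
  move=> fz gz; rewrite -dvd_mull ML1 dvd_mull; apply: L1_least.
    by rewrite -dvd_mull.
  by apply: resd => //; [apply: gen_dvd fz | apply: gen_dvd gz].
have kM z : dvd (ev n [:: i] * f') z -> dvd (ev n [:: j] * g') z -> dvd k (M^-1 * z).
  move=> fz gz; rewrite -dvd_mull ML2 dvd_mull; apply: L2_least.
    by rewrite -dvd_mull.
  by apply: resd => //; [apply: gen_dvd gz | apply: gen_dvd fz].
have My : exists2 v, all (gtn N) v & M^-1 * y = ev n v /\ size v < m.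
  have [v vN e] : dvd M y by apply: dvd_res.
  exists v => //; split=> //.
  have /peq_size : peq u ((i :: res i j) ++ v).
    apply: (@ev_inj n) => //; first by rewrite all_cat vN andbT /= iN all_res.
    by rewrite -ey ev_cat -e mulVKg.
  by move: um => /[swap] ->; rewrite /= size_cat; lia.
have [v3 v3N [ev3 v3m]] := My.
have [L3 [hL3 kL3 L3_least]] : exists L3, is_lcm h k L3.
  by apply: (IH _ _ _ _ _ _ _ v3 v3N ev3 v3m) => //; [apply: hM|apply: kM].
exists (M * L3); split.
- apply: (@dvd_trans (M * h)); last by rewrite dvd_mul2l.
  by rewrite ML1 dvd_mul2l.
- apply: (@dvd_trans (M * k)); last by rewrite dvd_mul2l.
  by rewrite ML2 dvd_mul2l.
- by move=> z fz gz; rewrite dvd_mull; apply: L3_least; [apply: hM|apply: kM].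
Qed.
End Positive.

Section DeltaElements.
Variable n : nat.
Let N := n.-1.
Implicit Types (x y z f g : braid n) (Y : pred nat) (u v w : seq nat).

Definition delta a k : braid n := ev n (Delta a k).
Definition gen i : braid n := ev n [:: i].

Lemma positive_gen i : i < N -> positive (gen i).
Proof. by move=> iN; exists [:: i] => //=; rewrite iN. Qed.

Lemma ev_consE i u : ev n (i :: u) = gen i * ev n u.
Proof. exact: ev_cons. Qed.

Lemma all_Delta_bound a k : a + k <= N -> all (gtn N) (Delta a k).
Proof. by move=> akN; apply: sub_all (all_Delta a k) => i /=; lia. Qed.

Lemma positive_delta a k : a + k <= N -> positive (delta a k).
Proof. by move=> akN; apply/positive_ev/all_Delta_bound. Qed.

Lemma gen_delta a k i j : a + k <= N -> i + j.+1 = k ->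
  gen (a + i) * delta a k = delta a k * gen (a + j).
Proof.
move=> akN ijk; rewrite -ev_consE -ev_cat cats1; apply: ev_peq (Delta_conj _ ijk) _.
by rewrite /= all_Delta_bound // andbT; lia.
Qed.

Lemma dvd_gen_delta a k i : a + k <= N -> a <= i < a + k ->
  dvd (gen i) (delta a k).
Proof.
move=> akN ik; have iN : i < N by lia.
apply/dvd_genP => //; first exact: all_Delta_bound.
by have := @Delta_divl a k (i - a); rewrite subnKC; [apply|]; lia.
Qed.

Lemma delta_least a k y : a + k <= N -> positive y ->
  (forall i, a <= i < a + k -> dvd (gen i) y) -> dvd (delta a k) y.
Proof.
move=> akN [u uN ->] uk.
apply/dvd_evP => //; first exact: all_Delta_bound.
apply: Delta_least => i ik; apply/(@dvd_genP n) => //; first by lia.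
by apply: uk; lia.
Qed.

Lemma gen_ev_far i u : i < N -> all (gtn N) u -> all (far i) u ->
  commute (gen i) (ev n u).
Proof.
move=> iN uN iu; rewrite /commute -ev_consE -ev_cat.
have := peq_far_word [::] iu; rewrite cats0 => /ev_peq -> //.
by rewrite /= iN.
Qed.

Lemma gen_delta_far i a k : i < N -> a + k <= N -> (i.+1 < a) || (a + k < i) ->
  commute (gen i) (delta a k).
Proof.
move=> iN akN iak; apply: gen_ev_far => //; first exact: all_Delta_bound.
by apply: sub_all (all_Delta a k) => j; rewrite /far; lia.
Qed.

Lemma gen_delta2 i a k : a + k <= N -> a <= i < a + k ->
  commute (gen i) (delta a k * delta a k).
Proof.
move=> akN /andP[ai ik].
have e1 : gen i * delta a k = delta a k * gen (a + (k - (i - a).+1)).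
  by rewrite -[i in LHS](subnKC ai) (@gen_delta _ _ _ (k - (i - a).+1)) //; lia.
have e2 : gen (a + (k - (i - a).+1)) * delta a k = delta a k * gen i.
  by rewrite (@gen_delta _ _ _ (i - a)) ?subnKC //; lia.
by rewrite /commute mulgA e1 -mulgA e2 mulgA.
Qed.

Lemma ev_size u v : all (gtn N) u -> all (gtn N) v -> ev n u = ev n v ->
  size u = size v.
Proof. by move=> uN vN /(ev_inj uN vN) /peq_size. Qed.

(* The lcm of [i] and [t <> i] starts with [i t], so all [t <> i] divide
   [i^-1 Delta]; it is not divisible by [i] too, being shorter than [Delta]. *)
Lemma delta_square_free i : i < N -> ~ dvd (gen i * gen i) (delta 0 N).
Proof.
move=> iN sqD; have iD : dvd (gen i) (delta 0 N) by apply: dvd_gen_delta.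
have : dvd (delta 0 N) ((gen i)^-1 * delta 0 N).
  apply: delta_least => // t /= tN; have [->|nti] := eqVneq t i.
    by rewrite -dvd_mull.
  have tD : dvd (gen t) (delta 0 N) by apply: dvd_gen_delta.
  have := dvd_res iN tN iD tD; rewrite ev_consE dvd_mull; apply: dvd_trans.
  have [it|it] := boolP (far i t); first by rewrite res_far //; apply: dvd_refl.
  rewrite res_adj // 1?eq_sym // ev_consE.
  by apply: dvd_mulr; apply: positive_gen.
case=> u uN e; have : delta 0 N = ev n (i :: Delta 0 N ++ u).
  by rewrite ev_consE ev_cat -e mulVKg mulVKg.
have DN : all (gtn N) (Delta 0 N) by apply: all_Delta_bound.
move=> e'; have : size (Delta 0 N) = size (i :: Delta 0 N ++ u).
  by apply: ev_size e' => //=; rewrite iN all_cat DN.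
by rewrite /= size_cat; lia.
Qed.

Lemma ev_flip u : all (gtn N) u ->
  ev n u * delta 0 N = delta 0 N * ev n (map (fun i => N - i.+1) u).
Proof.
elim: u => [|i u IH] /=; first by rewrite ev_nil mulg1 mul1g.
case/andP=> iN /IH e; rewrite ev_consE -mulgA e mulgA.
by rewrite (@gen_delta 0 N i (N - i.+1)) // ?ev_consE ?mulgA //; lia.
Qed.

(** The mirrored word is divisible by every letter of the mirrored interval, hence by the half twist
    of that interval; both have the same length, so nothing else is left. *)
Lemma delta_flip a k : a + k <= N ->
  delta a k * delta 0 N = delta 0 N * delta (N - (a + k)) k.
Proof.
move=> akN; have DN := all_Delta_bound akN.
rewrite {1}/delta ev_flip //; congr (_ * _); symmetry.
set z := map _ _.
have zN : all (gtn N) z by rewrite all_map; apply: sub_all DN => i /=; lia.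
have DN' : all (gtn N) (Delta (N - (a + k)) k) by apply: all_Delta_bound; lia.
have size_z : size z = size (Delta (N - (a + k)) k).
  rewrite size_map; elim: (k) (a) (N - _) => // l IH b c.
  by rewrite !DeltaS !size_cat !size_iota (IH b c).
have : dvd (delta (N - (a + k)) k) (ev n z).
  apply: delta_least; [lia | exact: positive_ev | move=> i ik].
  have flip_i : dvd (gen (N - i.+1)) (delta a k) by apply: dvd_gen_delta; lia.
  have iN : N - i.+1 < N by lia.
  have [w ew] := (dvd_genP iN DN).1 flip_i.
  apply/dvd_genP => //; first by lia.
  exists (map (fun i => N - i.+1) w).
  apply: (@ev_inj n) => //=.
    rewrite all_map; apply/andP; split; first by lia.
    have := DN; rewrite (all_peq _ ew) /= => /andP[_].
    by apply: sub_all => l /=; lia.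
  apply: (@mulgI _ (delta 0 N)); rewrite -ev_flip // (ev_peq ew DN).
  rewrite ev_flip /=; last by have := DN; rewrite (all_peq _ ew).
  by have -> : N - (N - i.+1).+1 = i by lia.
move=> /(dvd_evP DN' zN) [w]; move=> e.
have := peq_size e; rewrite size_cat size_z => sw.
have w0 : w = [::] by apply: size0nil; lia.
by rewrite (ev_peq e zN) w0 cats0.
Qed.

Definition D2 : braid n := ev n (Delta2 N).

Lemma D2E : D2 = delta 0 N * delta 0 N.
Proof. by rewrite /D2 ev_cat. Qed.

Lemma positive_D2 : positive D2.
Proof. by rewrite D2E; apply: positiveM; apply: positive_delta. Qed.

Lemma commute_gen_all x : (forall i, i < N -> commute (gen i) x) ->
  forall y, commute y x.
Proof.
move=> gx y; rewrite -[y]braid_of_word_repr.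
elim: (repr y) => [|[i b] w IH]; first exact/commute_sym/commute1.
rewrite -cat1s braid_of_word_cat; apply/commute_sym/commuteM; apply/commute_sym => //.
have gi := gx _ (ltn_ord i); rewrite /gen ev_ord in gi.
case: b => //; rewrite -[[:: _]]/(inv_word [:: (i, false)]) braid_of_word_inv.
exact/commute_sym/commuteV/commute_sym.
Qed.

Lemma D2_central x : commute x D2.
Proof.
by apply: commute_gen_all => i iN; rewrite D2E; apply: gen_delta2.
Qed.

Lemma D2X_central x k : commute x (D2 ^+ k).
Proof. exact/commuteX/D2_central. Qed.

(** Each inverse letter is absorbed by one factor Delta^2, which can be brought next to it. *)
Lemma positive_D2X x : exists k, positive (x * D2 ^+ k).
Proof.
rewrite -[x]braid_of_word_repr; elim: (repr x) => [|[i b] w [k IH]].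
  by exists 0; rewrite mulg1; exact: positive1.
rewrite -cat1s braid_of_word_cat; case: b.
  exists k.+1; rewrite -[[:: _]]/(inv_word [:: (i, false)]) braid_of_word_inv.
  have e a y : a * y * D2 ^+ k.+1 = a * D2 * (y * D2 ^+ k).
    by rewrite expgS !mulgA -(mulgA a y) (D2_central y) !mulgA.
  rewrite e; apply: positiveM => //; rewrite -/(sigma i) -ev_ord D2E mulgA.
  apply: positiveM; last exact: positive_delta.
  by apply: (@dvd_gen_delta 0 N) => //=.
exists k; rewrite -mulgA; apply: positiveM => //.
by rewrite -/(sigma i) -ev_ord; apply: (@positive_gen i).
Qed.
End DeltaElements.

(** * Centralizers of twists *)

Section Supported.
Variable n : nat.
Let N := n.-1.
Implicit Types (x y z a b : braid n) (Y : pred nat) (u v w : seq nat).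

Definition supported Y a :=
  exists2 w : word n, all (fun l : letter n => Y (val l.1)) w & a = braid_of_word w.

Lemma supported1 Y : supported Y 1.
Proof. by exists [::]. Qed.

Lemma supportedM Y a b : supported Y a -> supported Y b -> supported Y (a * b).
Proof.
case=> u uY -> [v vY ->]; exists (u ++ v); first by rewrite all_cat uY.
by rewrite braid_of_word_cat.
Qed.

Lemma supportedV Y a : supported Y a -> supported Y a^-1.
Proof.
case=> u uY ->; exists (inv_word u); last by rewrite braid_of_word_inv.
by rewrite /inv_word all_rev all_map; apply: sub_all uY => -[i b].
Qed.

Lemma supported_ev Y u : all Y u -> supported Y (ev n u).
Proof.
move=> uY; exists (pos_word n u) => //.
elim: u uY => //= i u IH /andP[iY /IH uY]; rewrite /pos_word /=.
by case: insubP => //= k _ ek; rewrite ek iY.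
Qed.

Lemma supported_ind Y (P : braid n -> Prop) :
  P 1 -> (forall a b, P a -> P b -> P (a * b)) -> (forall a, P a -> P a^-1) ->
  (forall i, i < N -> Y i -> P (gen n i)) -> forall a, supported Y a -> P a.
Proof.
move=> P1 PM PV Pg a [w wY ->]; elim: w wY => //= -[i b] w IH /andP[/= iY wY].
rewrite -cat1s braid_of_word_cat; apply: PM; last exact: IH.
have gi : P (sigma i) by have := Pg _ (ltn_ord i) iY; rewrite /gen ev_ord.
case: b => //; rewrite -[[:: _]]/(inv_word [:: (i, false)]) braid_of_word_inv.
exact: PV.
Qed.

Lemma supported_commute Y x :
  (forall i, i < N -> Y i -> commute (gen n i) x) ->
  forall a, supported Y a -> commute a x.
Proof.
move=> gx; apply: supported_ind => //; first exact/commute_sym/commute1.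
- by move=> a b ax bx; apply/commute_sym/commuteM; apply/commute_sym.
- by move=> a ax; apply/commute_sym/commuteV/commute_sym.
Qed.

(** A split of the given word rather than of the braid: a nonempty rest starts with [j], which is
    what [dvd_ribbon] asks for. *)
Lemma prefix_split j u :
  exists v w, [/\ u = v ++ w, all (predC1 j) v & w = [::] \/ exists t, w = j :: t].
Proof.
elim: u => [|i u [v [w [-> vj wj]]]]; first by exists [::], [::]; split=> //; left.
have [->|ij] := eqVneq i j.
  by exists [::], (j :: v ++ w); split=> //; right; eexists.
by exists (i :: v), w; split=> //=; rewrite ij.
Qed.
End Supported.

Section MaximalParabolic.
Variables (n j : nat).
Let N := n.-1.
Hypothesis jN : j < N.
Implicit Types (x y z a b : braid n) (Y : pred nat) (u v w : seq nat).

Definition delta_left : braid n := delta n 0 j.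
Definition delta_right : braid n := delta n j.+1 (N - j.+1).
Definition delta_max : braid n := delta_left * delta_right.
(** The two bundles of strands on the sides of the cut pass across each other once, with no crossing
    inside a bundle. *)
Definition ribbon : braid n := locked (delta_max^-1 * delta n 0 N).

Lemma commute_delta_left_right : commute delta_left delta_right.
Proof.
apply: (@supported_commute n (gtn j)) => [i iN /= ij|].
  by apply: gen_delta_far => //=; lia.
by apply: supported_ev; apply: sub_all (all_Delta 0 j) => i /=; lia.
Qed.

(** The permutation of the letters other than [j] induced by conjugation with [delta_max]: each side
    of the cut is reversed. *)
Definition star i := if i < j then j - i.+1 else N - (i - j).

Lemma star_bound i : i < N -> i != j -> (star i < N) && (star i != j).
Proof. by move=> iN ij; rewrite /star; case: ifP; lia. Qed.

Lemma starK i : i < N -> i != j -> star (star i) = i.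
Proof. by move=> iN ij; rewrite /star; do !case: ifP; lia. Qed.

Lemma gen_delta_max i : i < N -> i != j ->
  gen n i * delta_max = delta_max * gen n (star i).
Proof.
move=> iN nij; rewrite /star /delta_max; case: ifP => ij.
  rewrite mulgA /delta_left (@gen_delta _ 0 j i (j - i.+1)); [|lia|lia].
  rewrite -!mulgA; congr (_ * _).
  by apply: gen_delta_far => //=; lia.
have c : commute (gen n i) delta_left by apply: gen_delta_far => //=; lia.
rewrite mulgA c -!mulgA; congr (_ * _); rewrite /delta_right.
have := @gen_delta n j.+1 (N - j.+1) (i - j.+1) (N - i.+1).
have -> : j.+1 + (i - j.+1) = i by lia.
have -> : j.+1 + (N - i.+1) = N - (i - j) by lia.
by apply; lia.
Qed.

Lemma positive_delta_max : positive delta_max.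
Proof. by apply: positiveM; apply: positive_delta; lia. Qed.

Lemma delta_max_ev : delta_max = ev n (Delta 0 j ++ Delta j.+1 (N - j.+1)).
Proof. by rewrite ev_cat. Qed.

Lemma delta_max_word_avoids :
  all (predC1 j) (Delta 0 j ++ Delta j.+1 (N - j.+1)).
Proof.
rewrite all_cat; apply/andP; split;
  by apply: sub_all (all_Delta _ _) => i /=; lia.
Qed.

Lemma delta_max_word_bound :
  all (gtn N) (Delta 0 j ++ Delta j.+1 (N - j.+1)).
Proof. by rewrite all_cat !all_Delta_bound //; lia. Qed.

Lemma dvd_gen_delta_max i : i < N -> i != j -> dvd (gen n i) delta_max.
Proof.
move=> iN nij; have [ij|ij] := ltnP i j.
  apply: dvd_mulrl; last by apply: positive_delta; lia.
  by apply: dvd_gen_delta; lia.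
rewrite /delta_max commute_delta_left_right.
apply: dvd_mulrl; last by apply: positive_delta; lia.
by apply: dvd_gen_delta; lia.
Qed.

(** Letters right of the cut are far from those left of it, so they still divide what remains of [y]
    after [delta_left] is removed. *)
Lemma delta_max_least y : positive y ->
  (forall i, i < N -> i != j -> dvd (gen n i) y) -> dvd delta_max y.
Proof.
move=> py gy; have [u uN eu] : dvd delta_left y.
  by apply: delta_least => //; [lia | move=> i ij; apply: gy; lia].
rewrite /delta_max dvd_mull eu; apply: delta_least; [lia|exact: positive_ev|].
move=> i ij; have iN : i < N by lia.
apply/dvd_genP => //; have DN : all (gtn N) (Delta 0 j) by apply: all_Delta_bound; lia.
have DuN : all (gtn N) (Delta 0 j ++ u) by rewrite all_cat DN.
have := gy i iN ltac:(lia).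
have -> : y = ev n (Delta 0 j ++ u) by rewrite ev_cat -eu mulVKg.
move/(dvd_genP iN DuN) => [z]; apply: far_word_divl.
by apply: sub_all (all_Delta 0 j) => k; rewrite /far; lia.
Qed.

Lemma delta_maxK : delta_max * ribbon = delta n 0 N.
Proof. by rewrite /ribbon -lock mulVKg. Qed.

Lemma positive_ribbon : positive ribbon.
Proof.
rewrite /ribbon -lock; apply: delta_max_least; first exact: positive_delta.
by move=> i iN _; apply: dvd_gen_delta.
Qed.

(** Reversing a block and then the whole line is a translation: each block moves unchanged to the
    other side of the mirrored cut. *)
Lemma gen_ribbon i : i < N -> i != j ->
  gen n i * ribbon = ribbon * gen n (N - (star i).+1).
Proof.
move=> iN ij; have /andP[sN sj] := star_bound iN ij.
apply: (@mulgI _ delta_max); rewrite !mulgA delta_maxK.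
have := gen_delta_max sN sj; rewrite starK // => <-; rewrite -mulgA delta_maxK.
by rewrite (@gen_delta n 0 N _ (N - (star i).+1)) //; lia.
Qed.

(** Otherwise [delta_max] times [i], which is [star i] times [delta_max], would divide Delta, and
    with it the square of [star i]. *)
Lemma gen_not_dvd_ribbon i : i < N -> i != j -> ~ dvd (gen n i) ribbon.
Proof.
move=> iN ij; have /andP[sN sj] := star_bound iN ij => iR.
apply: (@delta_square_free n _ sN).
have e : gen n (star i) * delta_max = delta_max * gen n i.
  by rewrite gen_delta_max // starK.
apply: (@dvd_trans _ (gen n (star i) * delta_max)).
  by rewrite dvd_mul2l; apply: dvd_gen_delta_max.
by rewrite e -delta_maxK dvd_mul2l.
Qed.

(* The lcm of [ribbon] and the letter [i] is [i * ribbon]. *)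
Lemma dvd_ribbon_skip i z : positive z -> i < N -> i != j ->
  dvd ribbon (gen n i * z) -> dvd ribbon z.
Proof.
move=> pz iN ij rz; have /andP[sN sj] := star_bound iN ij.
have er := gen_ribbon iN ij.
have pg k : k < N -> positive (gen n k) by exact: positive_gen.
have rr : dvd ribbon (gen n i * ribbon).
  by rewrite er; apply/dvd_mulr/pg; lia.
have ir : dvd (gen n i) (gen n i * ribbon) by apply/dvd_mulr/positive_ribbon.
have [L [rL iL Lmin]] := lcm_exists positive_ribbon (pg _ iN) rr ir.
have Lz : dvd L (gen n i * z) by apply: Lmin rz _; apply: dvd_mulr.
have := Lmin _ rr ir; rewrite er => -[v vN ev_].
have [u uN eu] := rL.
have euv : ev n (u ++ v) = ev n [:: N - (star i).+1].
  by rewrite ev_cat -eu -ev_ -mulgA mulVKg mulKg.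
(* [L] lies between [ribbon] and [ribbon] times one letter, so it is one of the two; the first would
   make [i] divide [ribbon]. *)
have : size (u ++ v) = 1%N.
  by apply: ev_size euv; rewrite ?all_cat ?uN //= andbT; lia.
rewrite size_cat => s1.
case: u uN eu euv s1 => [|k u] uN eu euv s1.
  case: (gen_not_dvd_ribbon iN ij).
  by have := eu; rewrite ev_nil => e; have <- : L = ribbon
    by rewrite -[L](mulVKg ribbon) e mulg1.
have v0 : v = [::] by apply: size0nil; move: s1 => /=; lia.
move: ev_; rewrite v0 ev_nil -er => e.
have eL : L = gen n i * ribbon by rewrite -[RHS](mulVKg L) e mulg1.
by move: Lz; rewrite eL dvd_mul2l.
Qed.

Lemma dvd_ribbon_skip_word w z : positive z -> all (predC1 j) w ->
  all (gtn N) w -> dvd ribbon (ev n w * z) -> dvd ribbon z.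
Proof.
move=> pz; elim: w => [|i w IH] /=; first by rewrite ev_nil mul1g.
case/andP=> ij wj /andP[iN wN]; rewrite ev_consE -mulgA => rz.
by apply: IH => //; apply: dvd_ribbon_skip rz => //; apply/positiveM/pz/positive_ev.
Qed.

(** The product in the hypothesis is divisible by [j] through its right side and by all other
    letters through its left side, hence by Delta; then [delta_max] is cancelled and skipped.
    Allowing any positive [e] covers also the braids that carry the twists of one cut to those of
    the mirrored cut. *)
Lemma dvd_ribbon y e : dvd (gen n j) y -> positive e ->
  delta_max * delta_max * y = y * e -> dvd ribbon y.
Proof.
move=> jy pe eye; have py := dvd_positive (positive_gen jN) jy.
have pD := positive_delta_max.
have : dvd (delta n 0 N) (delta_max * (delta_max * y)).
  apply: delta_least => //; first by apply/positiveM/positiveM/py.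
  move=> i /= iN; have [->|ij] := eqVneq i j.
    by rewrite mulgA eye; apply: dvd_mulrl.
  apply: dvd_mulrl; last exact: positiveM.
  exact: dvd_gen_delta_max.
rewrite -delta_maxK dvd_mul2l delta_max_ev.
by apply: dvd_ribbon_skip_word; rewrite // ?delta_max_word_avoids ?delta_max_word_bound.
Qed.

Lemma supported_delta_max : supported (predC1 j) delta_max.
Proof. by rewrite delta_max_ev; apply/supported_ev/delta_max_word_avoids. Qed.

Lemma supported_commute_left a : supported (predC1 j) a ->
  commute a (delta_left * delta_left).
Proof.
apply: supported_commute => i iN /= nij; have [ij|ij] := ltnP i j.
  by apply: gen_delta2; lia.
by apply: commuteM; apply: gen_delta_far => //; lia.
Qed.

Lemma supported_commute_right a : supported (predC1 j) a ->
  commute a (delta_right * delta_right).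
Proof.
apply: supported_commute => i iN /= nij; have [ij|ij] := ltnP j i.
  by apply: gen_delta2; lia.
by apply: commuteM; apply: gen_delta_far => //; lia.
Qed.
End MaximalParabolic.

Section Flip.
Variables (n j : nat).
Let N := n.-1.
Hypothesis jN : j < N.
Let jb := N - j.+1.
Implicit Types (x y z a b : braid n).

Lemma delta_left_flip :
  delta_left n j * delta n 0 N = delta n 0 N * delta_right n jb.
Proof.
rewrite /delta_left delta_flip -/N; last by lia.
have -> : N - (0 + j) = jb.+1 by lia.
by rewrite /delta_right -/N (_ : N - jb.+1 = j) //; lia.
Qed.

Lemma delta_right_flip :
  delta_right n j * delta n 0 N = delta n 0 N * delta_left n jb.
Proof.
rewrite /delta_right delta_flip -/N; last by lia.
by have -> : N - (j.+1 + (N - j.+1)) = 0 by lia.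
Qed.

Lemma delta_max_flip :
  delta_max n j * delta n 0 N = delta n 0 N * delta_max n jb.
Proof.
rewrite /delta_max -mulgA delta_right_flip mulgA delta_left_flip -mulgA.
by rewrite [in RHS]commute_delta_left_right //; lia.
Qed.

Lemma delta_left_ribbon :
  delta_left n j * ribbon n j = ribbon n j * delta_right n jb.
Proof.
apply: (@mulgI _ (delta_max n j)); rewrite !mulgA delta_maxK -delta_left_flip.
have c : commute (delta_max n j) (delta_left n j).
  apply: commute_sym; apply: commuteM => //.
  exact: commute_delta_left_right.
by rewrite c -mulgA delta_maxK.
Qed.

Lemma delta_right_ribbon :
  delta_right n j * ribbon n j = ribbon n j * delta_left n jb.
Proof.
apply: (@mulgI _ (delta_max n j)); rewrite !mulgA delta_maxK -delta_right_flip.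
have c : commute (delta_max n j) (delta_right n j).
  apply: commute_sym; apply: commuteM => //.
  by apply: commute_sym; apply: commute_delta_left_right.
by rewrite c -mulgA delta_maxK.
Qed.

Lemma ribbon_ribbon :
  delta_max n j * delta_max n j * (ribbon n j * ribbon n jb) = D2 n.
Proof.
rewrite -mulgA [delta_max n j * (ribbon _ _ * _)]mulgA delta_maxK.
by rewrite mulgA delta_max_flip -mulgA delta_maxK D2E.
Qed.

Lemma supported_ribbon v : supported (predC1 jb) v ->
  exists2 v', supported (predC1 j) v' & ribbon n j * v = v' * ribbon n j.
Proof.
move: v; apply: supported_ind.
- by exists 1; [exact: supported1 | rewrite mulg1 mul1g].
- move=> a b [a' sa ea] [b' sb eb]; exists (a' * b'); first exact: supportedM.
  by rewrite mulgA ea -mulgA eb mulgA.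
- move=> a [a' sa ea]; exists a'^-1; first exact: supportedV.
  by apply: (@mulIg _ a); rewrite mulgVK -mulgA ea mulKg.
move=> i iN /= ij.
have kN : N - i.+1 < N by lia.
have kj : N - i.+1 != j by lia.
have /andP[sN sj] := star_bound jN kN kj.
exists (gen n (star n j (N - i.+1))).
  by apply: supported_ev => /=; rewrite andbT.
by rewrite gen_ribbon // starK // -/N (_ : N - (N - i.+1).+1 = i) //; lia.
Qed.
End Flip.

Section Centralizer.
Variables (n j : nat).
Let N := n.-1.
Hypotheses (jN : j < N) (N2 : 2 <= N).
Let jb := N - j.+1.
Implicit Types (x y z a b : braid n).
Local Notation A := (delta_left n j * delta_left n j).
Local Notation B := (delta_right n j * delta_right n j).
Local Notation Ab := (delta_left n jb * delta_left n jb).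
Local Notation Bb := (delta_right n jb * delta_right n jb).

(** Equal positive braids use the same letters, and an outermost letter, 0 or N - 1, tells the two
    sides apart. This excludes that the quotient by a single ribbon lies in the parabolic subgroup
    of the mirrored cut. *)
Lemma delta_left_right_flip_neq : A = Bb -> B = Ab -> False.
Proof.
rewrite /delta_left /delta_right /delta -!ev_cat.
have bound (a k : nat) : a + k <= N -> all (gtn N) (Delta a k ++ Delta a k).
  by move=> akN; rewrite all_cat !all_Delta_bound.
have mem (a k i : nat) : (i \in Delta a k ++ Delta a k) -> a <= i < a + k.
  by rewrite mem_cat orbb => /(allP (all_Delta a k)).
have in_iota (a k i : nat) : a <= i < a + k -> i \in Delta a k ++ Delta a k.
  by case: k => [|k] ik; [lia | rewrite DeltaS !mem_cat mem_iota ik].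
have [j0|j0] := posnP j.
  move=> _ /(ev_inj (bound _ _ _) (bound _ _ _)) H.
  have := H ltac:(lia) ltac:(lia) => /peq_support /(_ 0%N).
  rewrite (in_iota 0 jb); last by lia.
  by move/mem; lia.
move=> /(ev_inj (bound _ _ _) (bound _ _ _)) H _.
have := H ltac:(lia) ltac:(lia) => /peq_support /(_ N.-1).
rewrite (in_iota jb.+1); last by lia.
by move/mem; lia.
Qed.

Lemma delta_max_sq k : k < N -> delta_max n k * delta_max n k =
  (delta_left n k * delta_left n k) * (delta_right n k * delta_right n k).
Proof.
move=> kN; rewrite /delta_max -!mulgA; congr (_ * _); rewrite !mulgA.
by rewrite -(commute_delta_left_right kN).
Qed.

Lemma positive_centralizer y : positive y -> commute y A -> commute y B ->
  exists a m, supported (predC1 j) a /\ y = a * D2 n ^+ m.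
Proof.
case=> u uN ->; have [m] := ubnP (size u).
elim: m => // m IH in u uN *; rewrite ltnS => um yA yB.
have [v [w [eu vj hw]]] := prefix_split j u.
have sv : supported (predC1 j) (ev n v) by apply: supported_ev.
case: hw => [w0|[t ew]].
  by exists (ev n v), 0; split=> //; rewrite eu w0 cats0 mulg1.
have [vN wN] : all (gtn N) v /\ all (gtn N) w.
  by apply/andP; rewrite -all_cat -eu.
have y0E : (ev n v)^-1 * ev n u = ev n w by rewrite eu ev_cat mulKg.
have wA : commute (ev n w) A.
  rewrite -y0E; apply/commute_sym/commuteM/commute_sym => //.
  exact/commuteV/commute_sym/supported_commute_left.
have wB : commute (ev n w) B.
  rewrite -y0E; apply/commute_sym/commuteM/commute_sym => //.
  exact/commuteV/commute_sym/supported_commute_right.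
have pA k : k < N -> positive (delta_max n k * delta_max n k).
  by move=> kN; apply: positiveM; apply: positive_delta_max.
have rw : dvd (ribbon n j) (ev n w).
  apply: (@dvd_ribbon n j jN _ (delta_max n j * delta_max n j)).
  - rewrite ew ev_consE; apply/dvd_mulr/positive_ev.
    by move: wN; rewrite ew /= => /andP[].
  - exact: pA.
  - by rewrite delta_max_sq //; apply/commute_sym/commuteM.
have [y1w y1N e1] := rw; have {}e1 : ev n w = ribbon n j * ev n y1w.
  by rewrite -e1 mulVKg.
have jbN : jb < N by lia.
have rA : A * ribbon n j = ribbon n j * Bb.
  by rewrite -mulgA delta_left_ribbon // mulgA delta_left_ribbon // -mulgA.
have rB : B * ribbon n j = ribbon n j * Ab.
  by rewrite -mulgA delta_right_ribbon // mulgA delta_right_ribbon // -mulgA.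
have y1A : Bb * ev n y1w = ev n y1w * A.
  apply: (@mulgI _ (ribbon n j)).
  by rewrite mulgA -rA -mulgA -e1 -wA e1 -mulgA.
have y1B : Ab * ev n y1w = ev n y1w * B.
  apply: (@mulgI _ (ribbon n j)).
  by rewrite mulgA -rB -mulgA -e1 -wB e1 -mulgA.
have [v1 [w1 [ey1 v1j hw1]]] := prefix_split jb y1w.
have sv1 : supported (predC1 jb) (ev n v1) by apply: supported_ev.
have y1E : ev n y1w = ev n v1 * ev n w1 by rewrite ey1 ev_cat.
have cv1A := supported_commute_left jbN sv1.
have cv1B := supported_commute_right jbN sv1.
have w1A : Bb * ev n w1 = ev n w1 * A.
  apply: (@mulgI _ (ev n v1)); rewrite [RHS]mulgA -y1E -y1A y1E.
  by rewrite mulgA cv1B -mulgA.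
have w1B : Ab * ev n w1 = ev n w1 * B.
  apply: (@mulgI _ (ev n v1)); rewrite [RHS]mulgA -y1E -y1B y1E.
  by rewrite mulgA cv1A -mulgA.
(* With nothing left after [v1], the relations [w1A] and [w1B] would identify the twists of the two
   cuts. *)
case: hw1 => [w10|[t1 ew1]].
  case: delta_left_right_flip_neq.
    by move: w1A; rewrite w10 ev_nil mul1g mulg1.
  by move: w1B; rewrite w10 ev_nil mul1g mulg1.
have w1N : all (gtn N) w1 by move: y1N; rewrite ey1 all_cat => /andP[].
have rw1 : dvd (ribbon n jb) (ev n w1).
  apply: (@dvd_ribbon n jb jbN _ (delta_max n j * delta_max n j)).
  - rewrite ew1 ev_consE; apply/dvd_mulr/positive_ev.
    by move: w1N; rewrite ew1 /= => /andP[].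
  - exact: pA.
  - have AB : commute B A.
      apply: supported_commute_left => //; apply: supportedM;
        by apply: supported_ev; apply: sub_all (all_Delta _ _) => i /=; lia.
    by rewrite !delta_max_sq // -AB -(mulgA Ab) w1A mulgA w1B -mulgA.
have [y3 y3N e3] := rw1; have {}e3 : ev n w1 = ribbon n jb * ev n y3.
  by rewrite -e3 mulVKg.
have [v' sv' ev'] := supported_ribbon jN sv1.
(* [v'] is [v1] carried to the left across the ribbon, and the inverse square is what separates the
   product of the two ribbons from Delta^2 in [ribbon_ribbon]. *)
pose a0 := ev n v * v' * (delta_max n j * delta_max n j)^-1.
have sD : supported (predC1 j) (delta_max n j * delta_max n j).
  by apply: supportedM; apply: supported_delta_max.
have sa0 : supported (predC1 j) a0.
  by apply: supportedM; [apply: supportedM | apply: supportedV].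
have uE : ev n u = a0 * D2 n * ev n y3.
  have -> : a0 * D2 n = ev n v * v' * (ribbon n j * ribbon n jb).
    by rewrite /a0 -(ribbon_ribbon jN) -mulgA mulKg.
  by rewrite eu ev_cat e1 y1E e3 (mulgA (ribbon n j)) ev' !mulgA.
have cent x : supported (predC1 j) x -> commute x A /\ commute x B.
  by move=> sx; split; [apply: supported_commute_left|apply: supported_commute_right].
have y3E : ev n y3 = (a0 * D2 n)^-1 * ev n u by rewrite uE mulKg.
have [a0A a0B] := cent _ sa0.
have y3c x : commute a0 x -> commute (ev n u) x -> commute (ev n y3) x.
  move=> a0x ux; rewrite y3E; apply/commute_sym/commuteM/commute_sym => //.
  apply/commuteV/commuteM; first exact: commute_sym.
  exact: D2_central.
have [||||a [k [sa ea]]] := IH y3; rewrite //.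
(* The length drops because [ribbon] is not trivial: Delta contains the letter [j] and [delta_max]
   does not. *)
- have [[r rN er] [rb rbN erb]] := (positive_ribbon jN, positive_ribbon jbN).
  have r0 : 0 < size r.
    case: r rN er => // _ er; have := delta_maxK n j; rewrite er mulg1.
    rewrite delta_max_ev => /(ev_inj (delta_max_word_bound jN)) H.
    have jD : j \in Delta 0 N.
      by case: (N) jN => // l lj; rewrite DeltaS mem_cat mem_iota lj.
    have /peq_support/(_ j) := H (@all_Delta_bound n 0 N (leqnn N)).
    by rewrite jD => /(allP (delta_max_word_avoids jN)) /=; rewrite eqxx.
  have : size u = size (v ++ r ++ v1 ++ rb ++ y3).
    apply: (@ev_size n) => //.
      rewrite !all_cat vN rN rbN y3N.
      by move: y1N; rewrite ey1 all_cat => /andP[-> _].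
    by rewrite !ev_cat -er -erb -e3 -y1E -e1 -ev_cat -eu.
  by rewrite !size_cat; lia.
- exact: y3c.
- exact: y3c.
exists (a0 * a), k.+1; split; first exact: supportedM.
rewrite uE ea expgS -!(mulgA a0); congr (_ * _).
by rewrite !mulgA (D2_central a).
Qed.
End Centralizer.

(** * Crossing numbers *)

Definition swap_adj (i k : nat) : nat :=
  if k == i then i.+1 else if k == i.+1 then i else k.

Ltac swap_lia := rewrite /swap_adj; do !(case: eqP => /=); lia.

Lemma swap_adjK i : involutive (swap_adj i).
Proof. by move=> k; swap_lia. Qed.

Lemma swap_adjE i : (swap_adj i i = i.+1) * (swap_adj i i.+1 = i)
  * (swap_adj i i.+2 = i.+2) * (swap_adj i.+1 i = i).
Proof. by do !split; swap_lia. Qed.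

Lemma swap_adj_braid i k :
  swap_adj i (swap_adj i.+1 (swap_adj i k))
  = swap_adj i.+1 (swap_adj i (swap_adj i.+1 k)).
Proof.
have [->|k0] := eqVneq k i; first by rewrite !swap_adjE.
have [->|k1] := eqVneq k i.+1; first by rewrite !swap_adjE.
have [->|k2] := eqVneq k i.+2; first by rewrite !swap_adjE.
have ki : swap_adj i k = k by rewrite /swap_adj !ifF //; apply/negbTE.
have ki1 : swap_adj i.+1 k = k by rewrite /swap_adj !ifF //; apply/negbTE.
by rewrite !(ki, ki1).
Qed.

Definition nact (h : nat -> bool) (u : seq nat) : nat -> bool :=
  foldl (fun h i => h \o swap_adj i) h u.

Section Crossings.
Variable n : nat.
Let N := n.-1.
Implicit Types (h f : nat -> bool) (u v w g p q : word n).

Definition act h w := nact h [seq val l.1 | l : letter n <- w].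

(** Every strand carries two colours, assigned by its initial position and transported along the
    word; a crossing counts when its strands differ in both. *)
Fixpoint cross (b : bool) w h f : nat :=
  if w is (i, s) :: w' then
    [&& s == b, h i != h i.+1 & f i != f i.+1]
    + cross b w' (h \o swap_adj i) (f \o swap_adj i)
  else 0.

Lemma act_cat h u v : act h (u ++ v) = act (act h u) v.
Proof. by rewrite /act map_cat /nact foldl_cat. Qed.

Lemma act_cons h i s w : act h ((i, s) :: w) = act (h \o swap_adj i) w.
Proof. by []. Qed.

Lemma cross_cat b u v h f :
  cross b (u ++ v) h f = (cross b u h f + cross b v (act h u) (act f u))%N.
Proof. by elim: u h f => //= -[i s] u IH h f; rewrite IH addnA. Qed.

(** Equality of the signed crossing numbers, positive minus negative, arranged without
    subtraction. *)
Definition same_crossings u v h f :=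
  (cross false u h f + cross true v h f = cross false v h f + cross true u h f)%N.

Lemma braid_eq_act u v h : braid_eq u v -> act h u = act h v.
Proof.
move=> uv; elim: uv h => {u v}
  [//|u v _ IH h|u v w _ IH1 _ IH2 h|u u' v v' _ IH1 _ IH2 h|i b h|i j ij h|i j ij h].
- by rewrite IH.
- by rewrite IH1.
- by rewrite !act_cat IH1 IH2.
- by apply/funext => k; rewrite /act /nact /= swap_adjK.
- apply/funext => k; rewrite /act /nact /=; congr (h _); swap_lia.
- apply/funext => k; rewrite /act /nact /= ij; congr (h _); exact: swap_adj_braid.
Qed.

Lemma braid_eq_cross u v h f : braid_eq u v -> same_crossings u v h f.
Proof.
move=> uv; elim: uv h f => {u v} [|u v _ IH|u v w _ IH1 _ IH2|
  u u' v v' uu' IH1 vv' IH2|i b|i j ij|i j ij] h f; rewrite /same_crossings.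
- by [].
- by have := IH h f; rewrite /same_crossings; lia.
- by have := IH1 h f; have := IH2 h f; rewrite /same_crossings; lia.
- have := IH1 h f; have := IH2 (act h u) (act f u); rewrite /same_crossings.
  by rewrite !cross_cat !(braid_eq_act _ uu'); lia.
- rewrite /= !swap_adjE.
  by case: b => /=; rewrite [h _ == _]eq_sym [f _ == _]eq_sym; lia.
- have e1 : swap_adj i j = j by swap_lia.
  have e2 : swap_adj i j.+1 = j.+1 by swap_lia.
  have e3 : swap_adj j i = i by swap_lia.
  have e4 : swap_adj j i.+1 = i.+1 by swap_lia.
  by rewrite /= e1 e2 e3 e4; lia.
- by rewrite /= ij !swap_adjE; lia.
Qed.

Lemma act_inv_word h w : act (act h (inv_word w)) w = h.
Proof.
by rewrite -act_cat (braid_eq_act _ (inv_word_cat w)).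
Qed.

Lemma act_inj w : injective (fun h => act h w).
Proof.
move=> h f e; have : act (act h w) (inv_word w) = act (act f w) (inv_word w) by rewrite e.
by rewrite -!act_cat !(braid_eq_act _ (cat_inv_word w)).
Qed.

Definition cut (j : nat) : nat -> bool := fun k => k <= j.

Lemma cut_swap j i : i != j -> cut j \o swap_adj i = cut j.
Proof.
by move=> ij; apply/funext => k; rewrite /cut /=; swap_lia.
Qed.

Lemma cut_adj j i : i != j -> cut j i = cut j i.+1.
Proof. by rewrite /cut; lia. Qed.

Lemma act_cut j p : all (fun l : letter n => val l.1 != j) p ->
  act (cut j) p = cut j.
Proof.
elim: p => //= -[i s] p IH /andP[ij pj].
by rewrite act_cons cut_swap // IH.
Qed.

Lemma cross_cutl b j p f : all (fun l : letter n => val l.1 != j) p ->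
  cross b p (cut j) f = 0%N.
Proof.
elim: p f => //= -[i s] p IH f /andP[ij pj].
by rewrite cut_swap // IH // (cut_adj ij) eqxx /= andbF.
Qed.

Lemma crossC b w h f : cross b w h f = cross b w f h.
Proof.
by elim: w h f => //= -[i s] w IH h f; rewrite IH [(h _ != _) && _]andbC.
Qed.

Lemma cross_cutr b j p f : all (fun l : letter n => val l.1 != j) p ->
  cross b p f (cut j) = 0%N.
Proof. by rewrite crossC; apply: cross_cutl. Qed.

(** Colours given by the positions at the end of [g], read off at its start. *)
Definition pull f g := act f (inv_word g).

Lemma pullK f g : act (pull f g) g = f.
Proof. exact: act_inv_word. Qed.

Lemma pullP f g h : act h g = f -> h = pull f g.
Proof. by move=> hg; apply: (@act_inj g); rewrite pullK. Qed.

(* The crossings of sign [b] between strands separated by the cut [j] at the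
   start of [g] and by the cut [k] at its end. *)
Definition crossing_index b j k g := cross b g (cut j) (pull (cut k) g).

Definition same_index j k g g' :=
  (crossing_index false j k g + crossing_index true j k g'
   = crossing_index false j k g' + crossing_index true j k g)%N.

(** Letters of [p] cross only strands on the same side of the cut [j], letters of [q] only strands
    on the same side of [k]; neither is counted, and neither changes the respective cut. *)
Lemma same_index_double_coset j k p g q g' :
  all (fun l : letter n => val l.1 != j) p ->
  all (fun l : letter n => val l.1 != k) q ->
  braid_of_word g' = braid_of_word (p ++ g ++ q) -> same_index j k g g'.
Proof.
move=> pj qk /braid_of_wordP eg; rewrite /same_index /crossing_index.
set f' := pull _ g'.
have f'g : act f' (p ++ g ++ q) = cut k by rewrite -(braid_eq_act _ eg) pullK.
have f'pg : act (act f' p) g = cut k.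
  by apply: (@act_inj q); rewrite /= [RHS]act_cut //; move: f'g; rewrite !act_cat; apply.
rewrite -(pullP f'pg).
have := braid_eq_cross (cut j) f' eg; rewrite /same_crossings !cross_cat.
rewrite !(cross_cutl _ _ pj) f'pg (act_cut pj) !(cross_cutr _ _ qk).
by rewrite !add0n !addn0 => <-.
Qed.

Definition nonconstant h := exists x y, [/\ x <= N, y <= N & h x != h y].

Lemma nonconstant_act h w : nonconstant h -> nonconstant (act h w).
Proof.
elim: w h => //= -[i s] w IH h [x [y [xN yN hxy]]]; rewrite act_cons; apply: IH.
have iN : i < N by [].
exists (swap_adj i x), (swap_adj i y); rewrite /= !swap_adjK; split=> //; swap_lia.
Qed.

Lemma nonconstant_cut j : j < N -> nonconstant (cut j).
Proof. by move=> jN; exists j, j.+1; rewrite /cut leqnn ltnn; split=> //; lia. Qed.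

(** If [f] does not separate a pair separated by [h], take a point of the other [f]-colour: [h]
    separates it from one member of the pair. *)
Lemma separated_pair h f : nonconstant h -> nonconstant f ->
  exists x y, [/\ x < y, y <= N, h x != h y & f x != f y].
Proof.
move=> [x [y [xN yN hxy]]] [z [t [zN tN fzt]]].
suff [a [b [aN bN hab fab]]] : exists a b : nat,
    [/\ a <= N, b <= N, h a != h b & f a != f b].
  have [ab|ba|e] := ltngtP a b.
  - by exists a, b.
  - by exists b, a; split=> //; rewrite eq_sym.
  - by rewrite e eqxx in hab.
have [fxy|fxy] := eqVneq (f x) (f y); last by exists x, y.
have [w [wN fw]] : exists w : nat, w <= N /\ f w != f x.
  have [e|] := eqVneq (f z) (f x); last by exists z.
  by exists t; split=> //; rewrite -e eq_sym.
have [hw|hw] := eqVneq (h w) (h x); last by exists w, x.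
by exists w, y; split=> //; rewrite ?hw // -fxy.
Qed.
End Crossings.

Lemma nact_iota h a k x : nact h (iota a k) x =
  if x < a then h x else if x < a + k then h x.+1 else if x == a + k then h a else h x.
Proof.
elim: k a h => [|k IH] a h /=.
  by do !(case: ifP => /=); try lia; move=> /eqP->; rewrite addn0.
rewrite IH /= /swap_adj; do !(case: ifP => /=) => //; try lia.
all: by move=> *; congr (h _); lia.
Qed.

Lemma nact_Delta h a k x : nact h (Delta a k) x =
  if a <= x <= a + k then h (a + a + k - x) else h x.
Proof.
elim: k h => [|k IH] h.
  by rewrite /=; case: ifP => // H; congr (h _); lia.
rewrite DeltaS {1}/nact foldl_cat -/(nact h _) -/(nact _ _) IH !nact_iota.
do !(case: ifP => /=) => //; try lia.
all: by move=> *; congr (h _); lia.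
Qed.

Lemma nact_Delta2 h N : nact h (Delta2 N) = h.
Proof.
apply/funext => x; rewrite {1}/nact foldl_cat -/(nact h _) -/(nact _ _) !nact_Delta.
by do !(case: ifP => /=) => //; try lia; move=> *; congr (h _); lia.
Qed.

Section PositiveCrossings.
Variable n : nat.
Let N := n.-1.
Implicit Types (h f : nat -> bool) (u v : seq nat).

Definition pcross u h f := cross false (pos_word n u) h f.

Lemma pcross_cons i u h f : i < N -> pcross (i :: u) h f =
  ((h i != h i.+1) && (f i != f i.+1)
   + pcross u (h \o swap_adj i) (f \o swap_adj i))%N.
Proof. by move=> iN; rewrite /pcross /pos_word /= insubT. Qed.

Lemma act_pos_word h u : all (gtn N) u -> act h (pos_word n u) = nact h u.
Proof.
elim: u h => //= i u IH h /andP[iN uN].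
by rewrite /pos_word /= insubT /= act_cons IH.
Qed.

Lemma pcross_cat u v h f : all (gtn N) u ->
  pcross (u ++ v) h f = (pcross u h f + pcross v (nact h u) (nact f u))%N.
Proof.
by move=> uN; rewrite /pcross /pos_word pmap_cat cross_cat !act_pos_word.
Qed.

Lemma cross_true_pos_word u h f : cross true (pos_word n u) h f = 0%N.
Proof.
elim: u h f => //= i u IH h f; rewrite /pos_word /=.
by case: insubP => [k _ _|_] /=; rewrite ?IH.
Qed.

(** The strand starting at [a] runs across all the others in turn, so it meets the one from [x]. *)
Lemma pcross_iota a k h f x : a + k <= N -> a < x <= a + k ->
  h a != h x -> f a != f x -> 0 < pcross (iota a k) h f.
Proof.
elim: k a h f => [|k IH] a h f akN axk hx fx; first by lia.
rewrite /= pcross_cons; last by lia.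
have [ex|nx] := eqVneq x a.+1; first by rewrite -ex hx fx.
rewrite addn_gt0; apply/orP; right; apply: (IH a.+1) => //=; try lia.
  by rewrite !swap_adjE /swap_adj !ifF //; lia.
by rewrite !swap_adjE /swap_adj !ifF //; lia.
Qed.

Lemma pcross_Delta a k h f x y : a + k <= N -> a <= x -> x < y -> y <= a + k ->
  h x != h y -> f x != f y -> 0 < pcross (Delta a k) h f.
Proof.
elim: k h f x y => [|k IH] h f x y akN ax xy yk hxy fxy; first by lia.
rewrite DeltaS pcross_cat; last by apply/allP => i; rewrite mem_iota /=; lia.
rewrite addn_gt0; apply/orP; have [ex|nx] := eqVneq x a.
  by left; apply: (@pcross_iota _ _ _ _ y); rewrite -?ex //; lia.
(* The strand from [a] has moved to the far end, so the pair now stands one place lower. *)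
right; apply: (IH _ _ x.-1 y.-1); rewrite ?nact_iota; try lia.
  by do ![rewrite ifF; [|lia]|rewrite ifT; [|lia]]; rewrite !prednK //; lia.
by do ![rewrite ifF; [|lia]|rewrite ifT; [|lia]]; rewrite !prednK //; lia.
Qed.

Lemma nact_D2X h m : nact h (flatten (nseq m (Delta2 N))) = h.
Proof.
elim: m => //= m IH; rewrite {1}/nact foldl_cat -/(nact h _) nact_Delta2.
exact: IH.
Qed.

Lemma all_Delta2 : all (gtn N) (Delta2 N).
Proof. by rewrite all_cat (@all_Delta_bound n). Qed.

Lemma ev_D2X m : ev n (flatten (nseq m (Delta2 N))) = D2 n ^+ m.
Proof. by elim: m => //= m IH; rewrite ev_cat IH expgS. Qed.

Lemma all_D2X m : all (gtn N) (flatten (nseq m (Delta2 N))).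
Proof. by elim: m => //= m IH; rewrite all_cat all_Delta2. Qed.

Lemma pcross_D2X m h f : 0 < m -> nonconstant n h -> nonconstant n f ->
  0 < pcross (flatten (nseq m (Delta2 N))) h f.
Proof.
case: m => // m _ hc fc; have [x [y [xy yN hxy fxy]]] := separated_pair hc fc.
rewrite /= pcross_cat ?all_Delta2 // /Delta2 pcross_cat ?(@all_Delta_bound n) //.
by rewrite -addnA addn_gt0 (@pcross_Delta _ _ _ _ x y).
Qed.

(** The full twist permutes nothing, so it leaves the colourings alone; being positive it adds
    crossings of one sign only, and at least one by [separated_pair]. *)
Lemma crossing_index_D2X_neq j k m (w w' : word n) : j < N -> k < N -> 0 < m ->
  braid_of_word w' = braid_of_word w * D2 n ^+ m -> ~ same_index j k w w'.
Proof.
move=> jN kN m0; rewrite -ev_D2X -braid_of_word_cat => /braid_of_wordP e.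
set f' := pull (cut k) w'.
have f'w : act f' w = cut k.
  have : act f' (w ++ pos_word n (flatten (nseq m (Delta2 N)))) = cut k.
    by rewrite -(braid_eq_act _ e) pullK.
  by rewrite act_cat act_pos_word ?all_D2X // nact_D2X.
have := braid_eq_cross (cut j) f' e.
rewrite /same_crossings !cross_cat f'w cross_true_pos_word -/(pcross _ _ _).
have := pcross_D2X m0 (nonconstant_act w (nonconstant_cut jN)) (nonconstant_cut kN).
by rewrite /same_index /crossing_index -(pullP f'w) -/f'; lia.
Qed.

Lemma same_index_sym j k (w w' : word n) : same_index j k w w' -> same_index j k w' w.
Proof. by rewrite /same_index; lia. Qed.

Lemma same_index_trans j k (w1 w2 w3 : word n) :
  same_index j k w1 w2 -> same_index j k w2 w3 -> same_index j k w1 w3.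
Proof. by rewrite /same_index; lia. Qed.

Lemma same_index_D2X j k (w w' : word n) l m : j < N -> k < N ->
  same_index j k w w' ->
  braid_of_word w * D2 n ^+ l = braid_of_word w' * D2 n ^+ m -> l = m.
Proof.
move=> jN kN idx e; have [lm|ml|//] := ltngtP l m.
  case: (@crossing_index_D2X_neq j k (m - l) w' w) => //; first lia.
    by apply: (@mulIg _ (D2 n ^+ l)); rewrite e -mulgA -expgnDr subnK // ltnW.
case: (@crossing_index_D2X_neq j k (l - m) w w') => //; first lia.
by apply: (@mulIg _ (D2 n ^+ m)); rewrite -e -mulgA -expgnDr subnK // ltnW.
Qed.

Lemma same_index_supported j k (w w' : word n) a b :
  supported (predC1 j) a -> supported (predC1 k) b ->
  braid_of_word w' = a * braid_of_word w * b -> same_index j k w w'.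
Proof.
case=> wa aj -> [wb bk ->] e.
apply: (@same_index_double_coset _ _ _ wa w wb) => //.
by rewrite e -!braid_of_word_cat catA.
Qed.

End PositiveCrossings.

(** * Reduced fractions of positive braids *)

Section Fractions.
Variable n : nat.
Let N := n.-1.
Implicit Types (x y z a b : braid n) (Y : pred nat) (u v w : seq nat).

Definition coprime_left x y :=
  forall i, i < N -> dvd (gen n i) x -> dvd (gen n i) y -> False.

(** A central power f of Delta^2 makes g = u u'^-1 f positive, with f u = g u' and f v = g v'. The
    lcm of f and g divides both products, so its quotient by f divides [u] and [v] and is trivial;
    hence g divides f. *)
Lemma coprime_fraction_least u v u' v' :
  all (gtn N) u -> all (gtn N) v -> all (gtn N) u' -> all (gtn N) v' ->
  coprime_left (ev n u) (ev n v) ->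
  (ev n u)^-1 * ev n v = (ev n u')^-1 * ev n v' ->
  exists2 t, positive t & ev n u' = t * ev n u.
Proof.
move=> uN vN u'N v'N cop e.
have [k pg] := positive_D2X (ev n u / ev n u').
set f := D2 n ^+ k; set g := _ * _ in pg; rewrite -/f in g pg.
have pf : positive f.
  rewrite /f; elim: (k) => [|l IH]; first exact: positive1.
  by rewrite expgS; apply: positiveM => //; apply: positive_D2.
have fu : f * ev n u = g * ev n u'.
  by rewrite /g (D2X_central _ k) -/f -!mulgA mulVg mulg1.
have fv : f * ev n v = g * ev n v'.
  rewrite -[ev n v](mulVKg (ev n u)) e -[ev n v' in RHS](mulVKg (ev n u')).
  by rewrite !mulgA fu.
have pos := @positive_ev n.
have f_fu : dvd f (f * ev n u) by apply/dvd_mulr/pos.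
have g_fu : dvd g (f * ev n u) by rewrite fu; apply/dvd_mulr/pos.
have [L [fL gL Lmin]] := lcm_exists pf pg f_fu g_fu.
have Lu := Lmin _ f_fu g_fu.
have Lv : dvd L (f * ev n v).
  by apply: Lmin; [apply/dvd_mulr/pos | rewrite fv; apply/dvd_mulr/pos].
have eL : L = f * (f^-1 * L) by rewrite mulVKg.
rewrite eL !dvd_mul2l in Lu Lv.
have h1 : f^-1 * L = 1.
  have [//|[i [y [iN py ei]]]] := positiveP fL.
  have ih : dvd (gen n i) (f^-1 * L) by rewrite ei; apply: dvd_mulr.
  by case: (cop i iN); apply: dvd_trans ih _.
have [t tN et] : dvd g f by move: gL; rewrite eL h1 mulg1.
exists (ev n t); first exact: pos.
by apply: (@mulgI _ g); rewrite -fu mulgA -et mulVKg.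
Qed.

(** Each denominator is a multiple of the other, so by length the extra factors are empty. *)
Lemma coprime_fraction_unique u v u' v' :
  all (gtn N) u -> all (gtn N) v -> all (gtn N) u' -> all (gtn N) v' ->
  coprime_left (ev n u) (ev n v) -> coprime_left (ev n u') (ev n v') ->
  (ev n u)^-1 * ev n v = (ev n u')^-1 * ev n v' ->
  peq u u' /\ peq v v'.
Proof.
move=> uN vN u'N v'N cop cop' e.
have [t [s sN ->] et] := coprime_fraction_least uN vN u'N v'N cop e.
have [t' [s' s'N ->] et'] := coprime_fraction_least u'N v'N uN vN cop' (esym e).
have e1 : peq u' (s ++ u) by apply: (@ev_inj n); rewrite ?all_cat ?sN // ev_cat.
have e2 : peq u (s' ++ u') by apply: (@ev_inj n); rewrite ?all_cat ?s'N // ev_cat.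
have s0 : s = [::].
  by apply: size0nil; move: (peq_size e1) (peq_size e2); rewrite !size_cat; lia.
have e3 : peq u u' by rewrite e1 s0.
split=> //; apply: (@ev_inj n) => //.
by apply: (@mulgI _ (ev n u)^-1); rewrite e (ev_peq e3 uN).
Qed.

Lemma coprime_fraction_exists Y u v :
  all (gtn N) u -> all (gtn N) v -> all Y u -> all Y v ->
  exists u' v', [/\ all (gtn N) u' /\ all (gtn N) v', all Y u', all Y v',
    coprime_left (ev n u') (ev n v') &
    (ev n u)^-1 * ev n v = (ev n u')^-1 * ev n v'].
Proof.
have [m] := ubnP (size u); elim: m => // m IH in u v *; rewrite ltnS => um uN vN uY vY.
have [cop|] := pselect (coprime_left (ev n u) (ev n v)); first by exists u, v.
move=> /existsNP[i] /not_implyP[iN] /not_implyP[iu] /not_implyP[iv _].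
have [u1 eu] := (dvd_genP iN uN).1 iu; have [v1 ev1] := (dvd_genP iN vN).1 iv.
have all_tail (p : pred nat) w w' : peq w (i :: w') -> all p w -> all p w'.
  by move=> /all_peq -> /andP[].
have [u1N v1N] := (all_tail _ _ _ eu uN, all_tail _ _ _ ev1 vN).
have [u1Y v1Y] := (all_tail _ _ _ eu uY, all_tail _ _ _ ev1 vY).
have [|u' [v' [uv'N u'Y v'Y cop e]]] := IH u1 v1 _ u1N v1N u1Y v1Y.
  by have := peq_size eu; move=> /= su; lia.
exists u', v'; split=> //.
by rewrite (ev_peq eu uN) (ev_peq ev1 vN) !ev_consE invgM -mulgA mulKg.
Qed.
End Fractions.

(** * Intersections of parabolic subgroups and centralizers of all twists *)

Section Intersection.
Variable n : nat.
Let N := n.-1.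
Implicit Types (x y z a b : braid n) (Y : pred nat) (u v w : seq nat).

Lemma supported_fraction j a : j < N -> supported (predC1 j) a ->
  exists u v, [/\ all (gtn N) u /\ all (gtn N) v, all (predC1 j) u,
    all (predC1 j) v & a = (ev n u)^-1 * ev n v].
Proof.
move=> jN sa; have [D [DN Dj eD]] : exists D, [/\ all (gtn N) D, all (predC1 j) D &
    delta_max n j = ev n D].
  exists (Delta 0 j ++ Delta j.+1 (N - j.+1)).
  by rewrite delta_max_ev; split=> //;
    [apply: delta_max_word_bound|apply: delta_max_word_avoids].
have sD : supported (predC1 j) (ev n (D ++ D)).
  by apply: supported_ev; rewrite all_cat Dj.
have cD a' : supported (predC1 j) a' -> commute a' (ev n (D ++ D)).
  apply: supported_commute => i iN ij; rewrite ev_cat -eD delta_max_sq //.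
  have gi : supported (predC1 j) (gen n i) by apply: supported_ev; rewrite /= andbT.
  by apply: commuteM; [apply: supported_commute_left|apply: supported_commute_right].
suff [m [v [vN vj e]]] : exists m v, [/\ all (gtn N) v, all (predC1 j) v &
    a = (ev n (D ++ D) ^+ m)^-1 * ev n v].
  exists (flatten (nseq m (D ++ D))), v; split=> //.
  - by split=> //; elim: (m) => //= l IH; rewrite !all_cat DN.
  - by elim: (m) => //= l IH; rewrite !all_cat Dj.
  - rewrite e; congr (_^-1 * _); elim: (m) => [|l IH]; first by [].
    by rewrite expgS IH -ev_cat.
case: sa => w wj ->; elim: w wj => [|[i b] w IH] /=.
  by exists 0, [::]; rewrite ev_nil mulg1 expg0 invg1.
case/andP=> ij /IH [m [v [vN vj e]]]; have iN : i < N by [].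
rewrite -cat1s braid_of_word_cat e.
have gi : supported (predC1 j) (gen n i) by apply: supported_ev; rewrite /= andbT.
have gc := commuteV (commuteX m (cD _ gi)).
have sE : sigma i = gen n i by rewrite /gen ev_ord.
case: b; last first.
  exists m, (val i :: v); split; rewrite /= ?iN ?ij //.
  by rewrite ev_consE -/(sigma i) sE mulgA gc -mulgA.
(* From D = i z comes i^-1 = z D (D D)^-1, and D D commutes with everything in A_j; so fractions can
   be formed without the letter [j]. *)
have [z zN ez] : dvd (gen n i) (ev n D).
  by rewrite -eD; apply: dvd_gen_delta_max.
have ez' : ev n D = ev n (val i :: z) by rewrite ev_consE -ez mulVKg.
have eDz : peq D (val i :: z) by apply: (ev_inj _ _ ez') => //=; rewrite iN.
exists m.+1, (z ++ D ++ v); split.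
- by rewrite !all_cat zN DN.
- by rewrite !all_cat Dj vj !andbT; move: Dj; rewrite (all_peq _ eDz) /= => /andP[].
rewrite -[[:: _]]/(inv_word [:: (i, false)]) braid_of_word_inv -/(sigma i) sE.
have gVc x : commute (gen n i) x -> commute (gen n i)^-1 x.
  by move=> c; apply/commute_sym/commuteV/commute_sym.
rewrite mulgA (gVc _ gc) -mulgA expgS invgM -mulgA; congr (_ * _).
rewrite !ev_cat -ez.
have -> x y : x * ev n D * (ev n D * y) = x * ev n (D ++ D) * y.
  by rewrite ev_cat !mulgA.
by rewrite -(ev_cat n D D) (gVc _ (cD _ gi)) -mulgA mulKg.
Qed.

(** Reducing a fraction introduces no new letters, so the reduced fraction found in A_j avoids [j].
    By uniqueness all of them agree, and equal positive braids have the same letters. *)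
Lemma supported_bigcap (Y : pred nat) a j0 : j0 < N -> ~~ Y j0 ->
  (forall j, j < N -> ~~ Y j -> supported (predC1 j) a) -> supported Y a.
Proof.
move=> j0N j0Y aj.
have red j : j < N -> ~~ Y j -> exists u v,
    [/\ all (gtn N) u /\ all (gtn N) v, all (predC1 j) u, all (predC1 j) v,
      coprime_left (ev n u) (ev n v) & a = (ev n u)^-1 * ev n v].
  move=> jN jY; have [u [v [[uN vN] uj vj ->]]] := supported_fraction jN (aj _ jN jY).
  have [u' [v' [uvN u'j v'j cop e]]] := coprime_fraction_exists uN vN uj vj.
  by exists u', v'.
have [u [v [[uN vN] _ _ cop e]]] := red _ j0N j0Y.
suff uvY : forall j, j \in u ++ v -> Y j.
  rewrite e; apply: supportedM; first apply: supportedV.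
    by apply: supported_ev; apply/allP => j ju; apply: uvY; rewrite mem_cat ju.
  by apply: supported_ev; apply/allP => j jv; apply: uvY; rewrite mem_cat jv orbT.
move=> j juv; apply/negPn/negP => jY.
have jN : j < N.
  by move: juv; rewrite mem_cat => /orP[/(allP uN)|/(allP vN)].
have [u' [v' [[u'N v'N] u'j v'j cop' e']]] := red _ jN jY.
rewrite e in e'.
have [eu ev_] := coprime_fraction_unique uN vN u'N v'N cop cop' e'.
move: juv; rewrite mem_cat (peq_support eu) (peq_support ev_) => /orP[].
  by move/(allP u'j); rewrite /= eqxx.
by move/(allP v'j); rewrite /= eqxx.
Qed.

Definition twists (j : nat) : seq (braid n) :=
  [:: delta_left n j * delta_left n j; delta_right n j * delta_right n j].

Lemma supported_sub (Y Y' : pred nat) a :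
  (forall i, Y i -> Y' i) -> supported Y a -> supported Y' a.
Proof. by move=> YY' [w wY ->]; exists w => //; apply: sub_all wY => l /YY'. Qed.

Lemma supported_predC1 (Y : pred nat) j a : ~~ Y j -> supported Y a ->
  supported (predC1 j) a.
Proof.
by move=> jY; apply: supported_sub => i iY /=; apply: contraNneq jY => <-.
Qed.

Lemma maximal_centralizer j x : j < N -> 2 <= N ->
  (forall t, t \in twists j -> commute x t) ->
  exists a k l, supported (predC1 j) a /\ x * D2 n ^+ k = a * D2 n ^+ l.
Proof.
move=> jN N2 xt; have [k pk] := positive_D2X x.
have c y : commute x y -> commute (x * D2 n ^+ k) y.
  by move=> xy; apply/commute_sym/commuteM; [exact/commute_sym|exact: D2X_central].
have [||a [l [sa ea]]] := positive_centralizer jN N2 pk.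
- by apply/c/xt; rewrite inE eqxx.
- by apply/c/xt; rewrite !inE eqxx orbT.
by exists a, k, l.
Qed.

Lemma parabolic_centralizer (Y : pred nat) j0 x : 2 <= N -> j0 < N -> ~~ Y j0 ->
  (forall j t, j < N -> ~~ Y j -> t \in twists j -> commute x t) ->
  exists a k l, supported Y a /\ x * D2 n ^+ k = a * D2 n ^+ l.
Proof.
move=> N2 j0N j0Y xt.
have [a [k [l [sa ea]]]] := maximal_centralizer j0N N2 (fun t => xt _ t j0N j0Y).
exists a, k, l; split=> //; apply: (supported_bigcap j0N j0Y) => j jN jY.
have [b [k' [l' [sb eb]]]] := maximal_centralizer jN N2 (fun t => xt _ t jN jY).
have e : a * D2 n ^+ (l + k') = b * D2 n ^+ (l' + k).
  by rewrite !expgnDr !mulgA -ea -eb -!mulgA -!expgnDr addnC.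
(* Read as 1 * 1 * a and b * 1 * 1, both have the index of the trivial braid for the cuts [j] on the
   left and [j0] on the right, so they cannot differ by a power of Delta^2. *)
have e2 : l + k' = l' + k.
  rewrite -[a]braid_of_word_repr -[b]braid_of_word_repr in sa sb e.
  apply: (same_index_D2X jN j0N _ e).
  have bw1 : braid_of_word [::] = 1 :> braid n by [].
  apply: (@same_index_trans _ _ _ _ [::]).
    apply: same_index_sym; apply: (same_index_supported (supported1 _ _) sa).
    by rewrite bw1 !mul1g.
  apply: (same_index_supported sb (supported1 _ _)).
  by rewrite bw1 !mulg1.
have -> : a = b by apply: (@mulIg _ (D2 n ^+ (l + k'))); rewrite e e2.
by [].
Qed.

End Intersection.

(** * From double cosets to conjugacy instances *)

Section Reduction.
Variable n : nat.
Let N := n.-1.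
Implicit Types (x y z a b : braid n) (Y : pred nat) (u v w g : word n).

Definition twist_words (j : nat) : seq (word n) :=
  [:: pos_word n (Delta 0 j ++ Delta 0 j);
      pos_word n (Delta j.+1 (N - j.+1) ++ Delta j.+1 (N - j.+1))].

Lemma braid_of_twist_words j : map (@braid_of_word n) (twist_words j) = twists n j.
Proof. by rewrite /= -!/(ev n _) !ev_cat. Qed.

Definition cut_twists Y : seq (word n) :=
  flatten [seq twist_words j | j <- iota 0 N & ~~ Y j].

Lemma cut_twistsP Y x :
  (forall t, t \in cut_twists Y -> commute x (braid_of_word t)) <->
  (forall j t, j < N -> ~~ Y j -> t \in twists n j -> commute x t).
Proof.
split=> [xt j y jN jY|xt t /flatten_mapP[j]].
  rewrite -braid_of_twist_words => /mapP[t jt ->]; apply: xt.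
  by apply/flatten_mapP; exists j; rewrite // mem_filter jY mem_iota.
rewrite mem_filter mem_iota => /andP[jY jN] jt; apply: (xt j) => //.
by rewrite -braid_of_twist_words; apply: map_f.
Qed.

Lemma supported_commute_twists Y a t :
  supported Y a -> t \in cut_twists Y -> commute a (braid_of_word t).
Proof.
move=> sa; apply: ((cut_twistsP Y a).2 _ t) => {t} j t jN jY.
have saj := supported_predC1 jY sa.
rewrite !inE => /orP[] /eqP->; first exact: supported_commute_left.
exact: supported_commute_right.
Qed.

Definition conjugation_instance Y Y' g g' : seq (word n * word n) :=
  [seq (g' ++ t ++ inv_word g', g ++ t ++ inv_word g) | t <- cut_twists Y']
  ++ [seq (t, t) | t <- cut_twists Y].

Definition double_coset Y Y' x y := exists a b,
  [/\ supported Y a, supported Y' b & y = a * x * b].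

Lemma conjg_eq x y z : x ^ y = z <-> x * y = y * z.
Proof. by rewrite conjgE; split=> [<-|->]; rewrite ?mulVKg ?mulKg. Qed.

Lemma mulg_D2X x y z l m :
  x * z * y * D2 n ^+ (l + m) = (x * D2 n ^+ l) * z * (y * D2 n ^+ m).
Proof.
rewrite expgnDr -!mulgA (mulgA (D2 n ^+ l) z) -(D2X_central z) -mulgA.
by rewrite (mulgA (D2 n ^+ l) y) -(D2X_central y) -!mulgA.
Qed.

Lemma double_coset_reduction Y Y' j k g g' : 2 <= N ->
  j < N -> ~~ Y j -> k < N -> ~~ Y' k ->
  double_coset Y Y' (braid_of_word g) (braid_of_word g') <->
  (exists x, forall p, p \in conjugation_instance Y Y' g g' ->
    braid_of_word p.1 ^ x = braid_of_word p.2) /\ same_index j k g g'.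
Proof.
move=> N2 jN jY kN kY.
set G := braid_of_word g; set G' := braid_of_word g'.
split=> [[a [b [sa sb eG]]]|[[x xP] idx]].
  split; last first.
    exact: same_index_supported (supported_predC1 jY sa) (supported_predC1 kY sb) eG.
  exists a => p; rewrite mem_cat => /orP[] /mapP[t tY ->] /=; apply/conjg_eq.
    rewrite !braid_of_word_cat !braid_of_word_inv -/G' -/G.
    have aG : a * G = G' * b^-1 by rewrite eG mulgK.
    have bt : commute b^-1 (braid_of_word t).
      by apply: supported_commute_twists tY; apply: supportedV.
    rewrite [RHS]mulgA aG -[RHS]mulgA [b^-1 * _]mulgA bt -!mulgA; congr (_ * (_ * _)).
    by rewrite eG !invgM -!mulgA mulVg mulg1.
  by apply/commute_sym/(supported_commute_twists sa).
have xY t : t \in cut_twists Y -> commute x (braid_of_word t).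
  move=> tY; apply/commute_sym/conjg_eq; apply: (xP (t, t)).
  by rewrite mem_cat map_f ?orbT.
have [a [m [l [sa ea]]]] := parabolic_centralizer N2 jN jY ((cut_twistsP Y x).1 xY).
(* Chosen so that G' = x G y; the first part of the instance says that [y] commutes with the twists
   of [Y']. *)
pose y := G^-1 * x^-1 * G'.
have yY t : t \in cut_twists Y' -> commute y (braid_of_word t).
  move=> tY; rewrite -[y]invgK; apply/commute_sym/commuteV.
  have : (g' ++ t ++ inv_word g', g ++ t ++ inv_word g)
      \in conjugation_instance Y Y' g g'.
    by rewrite mem_cat; apply/orP; left; apply/mapP; exists t.
  move=> /xP /conjg_eq /=.
  rewrite !braid_of_word_cat !braid_of_word_inv -/G' -/G => e.
  have {}e : G' * (braid_of_word t * G'^-1) * x * G = x * G * braid_of_word t.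
    by rewrite e !mulgA mulgVK.
  apply: (@mulgI _ G'); rewrite /y !invgM !invgK /commute !mulgA.
  by rewrite mulgV mul1g -e !mulgA.
have [b [m' [l' [sb eb]]]] := parabolic_centralizer N2 kN kY ((cut_twistsP Y' y).1 yY).
(* Both central factors are collected here; the equality of indices then forces the two exponents to
   agree. *)
have eG' : a * G * b * D2 n ^+ (l + l') = G' * D2 n ^+ (m + m').
  have -> : G' = x * G * y by rewrite /y !mulgA mulgK mulgV mul1g.
  by rewrite !mulg_D2X -ea -eb.
rewrite -[a * G * b]braid_of_word_repr in eG'.
exists a, b; split=> //.
apply: (@mulIg _ (D2 n ^+ (m + m'))); rewrite -eG' braid_of_word_repr.
congr (_ * _ ^+ _); apply: (same_index_D2X jN kN _ eG').
apply: (same_index_trans _ idx); apply: same_index_sym.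
apply: (same_index_supported (supported_predC1 jY sa) (supported_predC1 kY sb)).
by rewrite braid_of_word_repr.
Qed.
End Reduction.

Local Close Scope group_scope.

(** * The program *)

Section Programs.
Variable oracle : data -> data.
Implicit Types (s : store) (c : command) (Q : store -> Prop).

Definition runs c s Q := exists2 s', exec oracle c s s' & Q s'.

Lemma runs_assign x e s Q : Q (update s x (eval s e)) -> runs (Assign x e) s Q.
Proof. by exists (update s x (eval s e)) => //; apply: exec_assign. Qed.

Lemma runs_query x e s Q :
  Q (update s x (oracle (eval s e))) -> runs (Query x e) s Q.
Proof. by exists (update s x (oracle (eval s e))) => //; apply: exec_query. Qed.

Lemma runs_seq c1 c2 s Q :
  runs c1 s (fun s1 => runs c2 s1 Q) -> runs (Seq c1 c2) s Q.
Proof. by case=> s1 e1 [s2 e2 Q2]; exists s2 => //; apply: exec_seq e1 e2. Qed.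

Lemma runs_conseq c s Q Q' : (forall s', Q s' -> Q' s') -> runs c s Q -> runs c s Q'.
Proof. by move=> QQ' [s' e q]; exists s' => //; apply: QQ'. Qed.

Lemma runs_while_stop e c s Q : eval s e = Leaf -> Q s -> runs (While e c) s Q.
Proof. by exists s => //; apply: exec_while_stop. Qed.

Lemma runs_while_step e c s Q : eval s e <> Leaf ->
  runs c s (fun s1 => runs (While e c) s1 Q) -> runs (While e c) s Q.
Proof.
by move=> se [s1 e1 [s2 e2 Q2]]; exists s2 => //; apply: exec_while_step e1 e2.
Qed.

Lemma updateE s x d y : update s x d y = if y == x then d else s y.
Proof. by []. Qed.

Lemma eq_dataP d e : reflect (d = e) (eq_data d e).
Proof.
apply: (iffP idP) => [|<-]; last by elim: d => //= d1 -> d2 ->.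
elim: d e => [|d1 IH1 d2 IH2] [|e1 e2] //=.
by case/andP => /IH1-> /IH2->.
Qed.

Section Table.
Variables (T : finType) (key : T -> data) (body : T -> command) (k t : nat).
Hypothesis key_inj : injective key.

(** A conditional: the loop body resets its own flag [t], so it runs at most once. *)
Definition case_command (a : T) :=
  Seq (Assign t (Equal (Var k) (Const (key a))))
    (While (Var t) (Seq (body a) (Assign t (Const Leaf)))).

Definition table :=
  foldr (fun a c => Seq (case_command a) c) (Assign t (Const Leaf)) (enum T).

Variables (a : T) (pre post : store -> Prop).
Hypotheses (pre_temp : forall s d, pre s -> pre (update s t d))
  (post_temp : forall s d, post s -> post (update s t d))
  (pre_key : forall s, pre s -> s k = key a)
  (post_key : forall s, post s -> s k = key a)
  (kt : k != t)
  (body_runs : forall s, pre s -> runs (body a) s post).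

(** The tests after the matching case are still executed: [post_key] makes them fail, and
    [post_temp] lets them overwrite the flag. *)
Lemma runs_table s : pre s -> runs table s post.
Proof.
have eval_key b s' : s' k = key a ->
    eval s' (Equal (Var k) (Const (key b))) = encode_bool (b == a).
  move=> e; rewrite /= e; congr encode_bool.
  by apply/eq_dataP/eqP => [/key_inj->|->].
have skip (e : seq T) : a \notin e -> forall s', post s' ->
    runs (foldr (fun a c => Seq (case_command a) c) (Assign t (Const Leaf)) e) s' post.
  elim: e => [_ s' ps|b e IH].
    by apply: runs_assign; apply: post_temp.
  rewrite inE negb_or => /andP[ab ae] s'' ps; apply/runs_seq/runs_seq/runs_assign.
  rewrite eval_key; last exact: post_key.
  rewrite eq_sym (negPf ab); apply: runs_while_stop; first by rewrite /= updateE eqxx.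
  by apply: IH => //; apply: post_temp.
rewrite /table; have := mem_enum T a; have := enum_uniq T.
elim: (enum T) s => //= b e IH s /andP[be ue]; rewrite inE => abe ps.
apply/runs_seq/runs_seq/runs_assign; rewrite eval_key; last exact: pre_key.
have [eab|nab] := eqVneq a b; last first.
  apply: runs_while_stop; first by rewrite /= updateE eqxx.
  apply: IH => //; first by move: abe; rewrite (negPf nab).
  exact: pre_temp.
subst b; apply: runs_while_step; first by rewrite /= updateE eqxx.
apply/runs_seq; apply: runs_conseq (body_runs (pre_temp _ ps)) => s' ps'.
apply/runs_assign/runs_while_stop; first by rewrite /= updateE eqxx.
by apply: skip => //; apply: post_temp.
Qed.
End Table.

Section InverseAppend.
Variable n : nat.
Implicit Types (w r : word n).

(** Popping from [x] and pushing on [y] reverses the word, and comparing a sign with [Leaf], the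
    code of [false], negates it. Concatenations are later obtained by inverting. *)
Definition inv_append (x y : nat) :=
  While (Var x)
    (Seq (Assign y (Pair (Pair (Head (Head (Var x)))
                            (Equal (Tail (Head (Var x))) (Const Leaf))) (Var y)))
       (Assign x (Tail (Var x)))).

Lemma inv_word_cons (l : letter n) w :
  inv_word (l :: w) = rcons (inv_word w) (l.1, ~~ l.2).
Proof. by rewrite /inv_word /= rev_cons. Qed.

Lemma runs_inv_append x y w r s Q : x != y ->
  s x = encode_word w -> s y = encode_word r ->
  (forall s', s' y = encode_word (inv_word w ++ r) ->
    (forall z, z != x -> z != y -> s' z = s z) -> Q s') ->
  runs (inv_append x y) s Q.
Proof.
move=> xy; elim: w r s => [|[i b] w IH] r s sx sy HQ.
  apply: runs_while_stop => //=; apply: HQ => //=.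
apply: runs_while_step; first by rewrite /= sx.
apply/runs_seq/runs_assign/runs_assign; apply: (IH ((i, ~~ b) :: r)).
- by rewrite !updateE eqxx /= !updateE (negPf xy) sx.
- by rewrite !updateE eq_sym (negPf xy) eqxx /= sx sy; case: b {sx HQ}.
move=> s' s'y s'z; apply: HQ; first by rewrite s'y inv_word_cons cat_rcons.
by move=> z zx zy; rewrite s'z // !updateE (negPf zx) (negPf zy).
Qed.

Definition prepend w (e : expr) : expr :=
  foldr (fun l e => Pair (Const (encode_letter l)) e) e w.

Lemma eval_prepend w r e s : eval s e = encode_word r ->
  eval s (prepend w e) = encode_word (w ++ r).
Proof. by move=> er; elim: w => //= l w ->. Qed.
End InverseAppend.
End Programs.

Section CrossingProgram.
Variables (oracle : data -> data) (n : nat).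
Implicit Types (s : store) (Q : store -> Prop) (h f : nat -> bool) (w : word n).

(** Restricted to the [n] positions a colouring is finite data, so one step of [cross] becomes a
    lookup in a finite table of constants. *)
Definition coloring := n.-tuple bool.
Definition color (c : coloring) : nat -> bool := nth false c.
Definition coloring_of h : coloring := [tuple h i | i < n].
Definition encode_coloring (c : coloring) : data := encode_seq encode_bool c.

Lemma color_of h k : k < n -> color (coloring_of h) k = h k.
Proof.
move=> kn; rewrite /color -[k]/(val (Ordinal kn)) -tnth_nth.
by rewrite tnth_mktuple.
Qed.

Lemma coloring_of_eq h f : (forall k, k < n -> h k = f k) ->
  coloring_of h = coloring_of f.
Proof. by move=> hf; apply: eq_from_tnth => i; rewrite !tnth_mktuple hf. Qed.

Lemma encode_coloring_inj : injective encode_coloring.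
Proof.
move=> c d /encode_seq_inj cd; apply/val_inj/cd.
by case=> [] [].
Qed.

Definition case_type : finType := (letter n * coloring * coloring)%type.

Definition encode_case (a : case_type) : data :=
  Node (encode_letter a.1.1)
    (Node (encode_coloring a.1.2) (encode_coloring a.2)).

Lemma encode_case_inj : injective encode_case.
Proof.
pose hd d := if d is Node d1 _ then d1 else Leaf.
pose tl d := if d is Node _ d2 then d2 else Leaf.
move=> [[l c] d] [[l' c'] d'] e.
have /encode_letter_inj el : encode_letter l = encode_letter l' := congr1 hd e.
have /encode_coloring_inj ec : encode_coloring c = encode_coloring c'.
  exact: (congr1 (fun x => hd (tl x)) e).
have /encode_coloring_inj ed : encode_coloring d = encode_coloring d'.
  exact: (congr1 (fun x => tl (tl x)) e).
by rewrite el ec ed.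
Qed.

Definition swap_coloring (l : letter n) (c : coloring) : coloring :=
  coloring_of (color c \o swap_adj (val l.1)).

Lemma swap_coloring_of (l : letter n) h :
  swap_coloring l (coloring_of h) = coloring_of (h \o swap_adj (val l.1)).
Proof.
apply: coloring_of_eq => k kn /=; apply: color_of.
by have := ltn_ord l.1; rewrite /swap_adj; do !case: ifP; lia.
Qed.

Definition crosses (a : case_type) : bool :=
  let i := val a.1.1.1 in
  (color a.1.2 i != color a.1.2 i.+1) && (color a.2 i != color a.2 i.+1).

(* Variables: 5 holds the word being read, 10 the key of the table, 11 is a
   temporary, 12 and 13 hold the two colourings. *)
Definition case_body (p q : nat) (a : case_type) : command :=
  let v := if a.1.1.2 then q else p in
  Seq (Assign 12 (Const (encode_coloring (swap_coloring a.1.1 a.1.2))))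
    (Seq (Assign 13 (Const (encode_coloring (swap_coloring a.1.1 a.2))))
       (Assign v (if crosses a then Pair (Const Leaf) (Var v) else Var v))).

Definition count_crossings (p q : nat) : command :=
  While (Var 5)
    (Seq (Assign 10 (Pair (Head (Var 5)) (Pair (Var 12) (Var 13))))
       (Seq (table encode_case (case_body p q) 10 11)
          (Assign 5 (Tail (Var 5))))).

Lemma runs_count_crossings p q w h f a b s Q :
  13 < p -> 13 < q -> p != q ->
  s 5 = encode_word w -> s 12 = encode_coloring (coloring_of h) ->
  s 13 = encode_coloring (coloring_of f) ->
  s p = encode_nat a -> s q = encode_nat b ->
  (forall s', s' 12 = encode_coloring (coloring_of (act h w)) ->
    s' 13 = encode_coloring (coloring_of (act f w)) ->
    s' p = encode_nat (a + cross false w h f) ->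
    s' q = encode_nat (b + cross true w h f) ->
    (forall z, z < 5 \/ 13 < z -> z != p -> z != q -> s' z = s z) -> Q s') ->
  runs oracle (count_crossings p q) s Q.
Proof.
move=> p13 q13 pq; elim: w h f a b s => [|l w IH] h f a b s s5 s12 s13 sp sq HQ.
  by apply: runs_while_stop => //=; apply: HQ; rewrite ?addn0.
apply: runs_while_step; first by rewrite /= s5.
apply/runs_seq/runs_assign/runs_seq.
pose key := (l, coloring_of h, coloring_of f) : case_type.
pose keeps (s' : store) := [/\ s' 5 = encode_word (l :: w), s' 10 = encode_case key &
  forall z, z < 5 \/ 13 < z -> z != p -> z != q -> s' z = s z].
pose pre s' := [/\ keeps s', s' 12 = encode_coloring (coloring_of h),
  s' 13 = encode_coloring (coloring_of f), s' p = encode_nat a & s' q = encode_nat b].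
pose h' := h \o swap_adj (val l.1); pose f' := f \o swap_adj (val l.1).
pose a' := (a + (~~ l.2 && crosses key)); pose b' := (b + (l.2 && crosses key)).
pose post s' := [/\ keeps s', s' 12 = encode_coloring (coloring_of h'),
  s' 13 = encode_coloring (coloring_of f'), s' p = encode_nat a' & s' q = encode_nat b'].
have key_crosses : crosses key =
    (h (val l.1) != h (val l.1).+1) && (f (val l.1) != f (val l.1).+1).
  by rewrite /crosses /key /= !color_of //; have := ltn_ord l.1; lia.
have up t d z s' : z != t -> update s' t d z = s' z.
  by move=> /negPf zt; rewrite updateE zt.
have neq z : 13 < z -> [/\ z != 5, z != 10, z != 11, z != 12 & z != 13].
  by move=> z13; split; apply: contraTneq z13 => ->.
have [p5 p10 p11 p12 p13'] := neq p p13; have [q5 q10 q11 q12 q13'] := neq q q13.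
have table_runs : runs oracle (table encode_case (case_body p q) 10 11)
    (update s 10 (eval s (Pair (Head (Var 5)) (Pair (Var 12) (Var 13))))) post.
  apply: (@runs_table _ _ _ _ _ _ encode_case_inj key pre post).
  - move=> s' d [[e5 e10 ez] e12 e13 ep eq_].
    rewrite /pre /keeps !up //; split=> //; split=> // z zr zp zq.
    by rewrite up ?ez //; lia.
  - move=> s' d [[e5 e10 ez] e12 e13 ep eq_].
    rewrite /post /keeps !up //; split=> //; split=> // z zr zp zq.
    by rewrite up ?ez //; lia.
  - by move=> s' [[]].
  - by move=> s' [[]].
  - move=> s' [[e5 e10 ez] e12 e13 ep eq_].
    rewrite /case_body; set v := if _ then _ else _.
    apply/runs_seq/runs_assign/runs_seq/runs_assign/runs_assign.
    set s'' := update _ 13 _.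
    have s''v : eval s'' (if crosses key then Pair (Const Leaf) (Var v) else Var v)
        = encode_nat (crosses key + (if l.2 then b else a)).
      have -> : encode_nat (crosses key + (if l.2 then b else a)) =
          if crosses key then Node Leaf (s' v) else s' v.
        by rewrite /v /=; case: (l.2); rewrite ?ep ?eq_; case: crosses.
      by rewrite /s''; case: crosses => /=; rewrite !up // /v; case: ifP.
    have v13 : [/\ v != 5, v != 10, v != 12 & v != 13] by rewrite /v; case: ifP.
    case: v13 => v5 v10 v12 v13.
    rewrite s''v /post /keeps; split.
    - rewrite /s'' !up // 1?eq_sym //; split=> // z zr zp zq.
      have zv : z != v by rewrite /v; case: ifP.
      have [z12 z13] : z != 12 /\ z != 13 by split; case: zr; apply: contraTneq => ->.
      by rewrite !up ?ez.
    - by rewrite up 1?eq_sym // /s'' up // updateE eqxx swap_coloring_of.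
    - by rewrite up; [rewrite /s'' updateE eqxx /= swap_coloring_of | rewrite eq_sym].
    - rewrite /v /a' /=; case: (l.2) => /=.
        by rewrite addn0 up // /s'' !up.
      by rewrite updateE eqxx addnC.
    - rewrite /v /b' /=; case: (l.2) => /=.
        by rewrite updateE eqxx addnC.
      by rewrite addn0 up 1?eq_sym // /s'' !up.
  rewrite /pre /keeps [update _ _ _ 10]updateE eqxx /= s5 s12 s13 /= !up //.
  split=> //.
  by split=> // z zr zp zq; rewrite up //; lia.
apply: runs_conseq table_runs => s1 [[s1_5 s1_10 s1z] s1_12 s1_13 s1p s1q].
apply: runs_assign; apply: (IH h' f' a' b'); [
  by rewrite updateE eqxx /= s1_5 | by rewrite up .. | ].
move=> s2 e12 e13 ep eq_ ez; apply: HQ.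
- exact: e12.
- exact: e13.
- rewrite ep /a' /h' /f' key_crosses -addnA; congr (encode_nat (_ + _)).
  by case: (l) => i [].
- rewrite eq_ /b' /h' /f' key_crosses -addnA; congr (encode_nat (_ + _)).
  by case: (l) => i [].
move=> z zr zp zq; rewrite ez // up ?s1z //; lia.
Qed.
End CrossingProgram.

Section ReductionProgram.
Variables (oracle : data -> data) (n : nat).
Implicit Types (s : store) (Q : store -> Prop) (w g u : word n).

(** The inverse d g^-1 c^-1 is built first, since reading the input inverts it anyway; a second
    inversion gives c g d^-1, and both words are kept for later. *)
Definition load_word (c d : word n) (e : expr) (x y : nat) : command :=
  Seq (Assign 5 e)
    (Seq (Assign y (Const (encode_word (inv_word c))))
       (Seq (inv_append 5 y)
          (Seq (Assign y (prepend d (Var y)))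
             (Seq (Assign 5 (Var y))
                (Seq (Assign x (Const Leaf)) (inv_append 5 x)))))).

(* A word for the braid [c g d^-1]. *)
Definition loaded (c d g : word n) : word n :=
  inv_word (d ++ (inv_word g ++ inv_word c)).

Lemma update_neq s x d z : z != x -> update s x d z = s z.
Proof. by rewrite updateE => /negPf->. Qed.

Lemma update_eq s x d : update s x d x = d.
Proof. by rewrite updateE eqxx. Qed.

Lemma runs_load_word c d e x y g s Q : x != 5 -> y != 5 -> x != y ->
  eval s e = encode_word g ->
  (forall s', s' x = encode_word (loaded c d g) ->
    s' y = encode_word (inv_word (loaded c d g)) ->
    (forall z, z != 5 -> z != x -> z != y -> s' z = s z) -> Q s') ->
  runs oracle (load_word c d e x y) s Q.
Proof.
move=> x5 y5 xy se HQ; apply/runs_seq/runs_assign/runs_seq/runs_assign/runs_seq.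
have y5' : 5 != y by rewrite eq_sym.
apply: (@runs_inv_append _ n _ _ g (inv_word c)) => //.
- by rewrite update_neq // update_eq.
- by rewrite update_eq.
move=> s1 s1y s1z; apply/runs_seq/runs_assign/runs_seq/runs_assign/runs_seq/runs_assign.
rewrite (eval_prepend _ (s1y : eval s1 (Var y) = _)).
have x5' : 5 != x by rewrite eq_sym.
have yx : y != x by rewrite eq_sym.
apply: (@runs_inv_append _ n _ _ (d ++ (inv_word g ++ inv_word c)) [::]) => //.
- by rewrite update_neq // update_eq /= update_eq.
- by rewrite update_eq.
move=> s2 s2x s2z; apply: HQ; first by rewrite s2x cats0.
  by rewrite s2z // update_neq // update_neq // update_eq /loaded inv_wordK.
move=> z z5 zx zy; rewrite s2z // !update_neq // s1z // !update_neq //.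
Qed.

(** The program for the tail runs before the head is pushed, so that [acc] ends in the order of
    [ts]. *)
Definition append_conjugates (ts : seq (word n)) (y acc : nat) : command :=
  foldr (fun t c =>
    Seq c (Seq (Assign 8 (prepend t (Var y)))
             (Seq (Assign 5 (Var y))
                (Seq (inv_append 5 8) (Assign acc (Pair (Var 8) (Var acc)))))))
    (Assign 5 (Const Leaf)) ts.

Lemma runs_append_conjugates ts y acc u r s Q :
  y != 5 -> y != 8 -> y != acc -> acc != 5 -> acc != 8 ->
  s y = encode_word u -> s acc = encode_seq (@encode_word n) r ->
  (forall s', s' acc =
      encode_seq (@encode_word n) ([seq inv_word u ++ t ++ u | t <- ts] ++ r) ->
    (forall z, z != 5 -> z != 8 -> z != acc -> s' z = s z) -> Q s') ->
  runs oracle (append_conjugates ts y acc) s Q.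
Proof.
move=> y5 y8 ya a5 a8 sy sa; elim: ts Q => [|t ts IH] Q HQ /=.
  apply: runs_assign; apply: HQ; first by rewrite update_neq.
  by move=> z z5 z8 za; rewrite update_neq.
apply/runs_seq/IH => s1 s1a s1z.
have s1y : s1 y = encode_word u by rewrite s1z.
apply/runs_seq/runs_assign/runs_seq/runs_assign/runs_seq.
rewrite (eval_prepend _ (s1y : eval s1 (Var y) = _)).
apply: (@runs_inv_append _ n _ _ u (t ++ u)) => //.
  by rewrite update_eq /= update_neq.
move=> s2 s2_8 s2z; apply: runs_assign; apply: HQ.
  by rewrite update_eq /= s2_8 s2z // !update_neq // s1a.
by move=> z z5 z8 za; rewrite update_neq // s2z // !update_neq // s1z.
Qed.

(** The first pass reads the inverse word with one colouring constant: it counts nothing and only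
    turns the cut [k] into its [pull], left in variable 13. The second pass does the counting. *)
Definition count_index (j k x y p q : nat) : command :=
  Seq (Assign 12 (Const (encode_coloring (coloring_of n (fun=> false)))))
    (Seq (Assign 13 (Const (encode_coloring (coloring_of n (cut k)))))
       (Seq (Assign 5 (Var y))
          (Seq (count_crossings n p q)
             (Seq (Assign 12 (Const (encode_coloring (coloring_of n (cut j)))))
                (Seq (Assign 5 (Var x)) (count_crossings n p q)))))).

Lemma cross_const b w (f : nat -> bool) : cross b w (fun=> false) f = 0.
Proof. elim: w f => //= -[i s] w IH f; rewrite andbF; exact: IH. Qed.

Lemma runs_count_index j k x y p q g a b s Q :
  x < 5 -> y < 5 -> 13 < p -> 13 < q -> p != q ->
  s x = encode_word g -> s y = encode_word (inv_word g) ->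
  s p = encode_nat a -> s q = encode_nat b ->
  (forall s', s' p = encode_nat (a + crossing_index false j k g) ->
    s' q = encode_nat (b + crossing_index true j k g) ->
    (forall z, z < 5 \/ 13 < z -> z != p -> z != q -> s' z = s z) -> Q s') ->
  runs oracle (count_index j k x y p q) s Q.
Proof.
move=> x5 y5 p13 q13 pq sx sy sp sq HQ.
have out z : z < 5 \/ 13 < z -> [/\ z != 5, z != 12 & z != 13].
  by move=> zr; split; case: zr; apply: contraTneq => ->.
have [p5 p12 p13'] := out p (or_intror p13).
have [q5 q12 q13'] := out q (or_intror q13).
have [x5' x12 x13] := out x (or_introl x5).
have [y5' y12 y13] := out y (or_introl y5).
have lt_neq z t : z < 5 -> 13 < t -> z != t.
  by move=> z5; apply: contraTneq => <-; rewrite -leqNgt ltnW // (ltn_trans z5).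
have [xp xq yp yq] := And4 (lt_neq _ _ x5 p13) (lt_neq _ _ x5 q13)
  (lt_neq _ _ y5 p13) (lt_neq _ _ y5 q13).
apply/runs_seq/runs_assign/runs_seq/runs_assign/runs_seq/runs_assign/runs_seq.
apply: (@runs_count_crossings _ n p q (inv_word g) (fun=> false) (cut k) a b) => //.
- by rewrite update_eq /= !update_neq.
- by rewrite !update_neq.
- by rewrite !update_neq.
move=> s1 s1_12 s1_13 s1p s1q s1z.
apply/runs_seq/runs_assign/runs_seq/runs_assign.
rewrite !cross_const !addn0 in s1p s1q.
have s1x : s1 x = encode_word g by rewrite s1z ?update_neq //; left.
apply: (@runs_count_crossings _ n p q g (cut j) (pull (cut k) g) a b) => //.
- by rewrite update_eq /= update_neq.
- by rewrite !update_neq.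
- by rewrite !update_neq.
move=> s2 _ _ s2p s2q s2z; apply: HQ => // z zr zp zq.
have [z5 z12 z13] := out z zr.
by rewrite s2z // !update_neq // s1z // !update_neq.
Qed.

(* Variables: 1 and 3 hold the two input words normalized by [loaded], 2 and 4
   their inverses, 6 and 7 the two lists of the query, 9 its answer; 14 and 15
   accumulate the two sides of [same_index], so the second word uses them in
   the opposite order. *)
Definition reduction_program (Y Y' : pred nat) (c d : word n) (j k : nat) : command :=
  Seq (load_word c d (Head (Var 0)) 1 2)
  (Seq (load_word c d (Tail (Var 0)) 3 4)
  (Seq (Assign 6 (Const (encode_seq (@encode_word n) (cut_twists n Y))))
  (Seq (append_conjugates (cut_twists n Y') 2 6)
  (Seq (Assign 7 (Const (encode_seq (@encode_word n) (cut_twists n Y))))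
  (Seq (append_conjugates (cut_twists n Y') 4 7)
  (Seq (Query 9 (Pair (Var 7) (Var 6)))
  (Seq (Assign 16 (Const Leaf))
  (Seq (While (Var 9)
     (Seq (Assign 14 (Const Leaf))
     (Seq (Assign 15 (Const Leaf))
     (Seq (count_index j k 1 2 14 15)
     (Seq (count_index j k 3 4 15 14)
     (Seq (Assign 16 (Equal (Var 14) (Var 15)))
          (Assign 9 (Const Leaf))))))))
  (Assign 0 (Var 16)))))))))).

Lemma oracle_instance (ps : seq (word n * word n)) :
  solves_simultaneous_conjugacy n oracle ->
  oracle (Node (encode_seq (@encode_word n) [seq p.1 | p <- ps])
               (encode_seq (@encode_word n) [seq p.2 | p <- ps])) <> Leaf <->
  exists x : braid n, forall p, p \in ps ->
    conjg (braid_of_word p.1) x = braid_of_word p.2.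
Proof.
move=> /(_ _ (map_tuple fst (in_tuple ps)) (map_tuple snd (in_tuple ps))).
have conjP (x : braid n) : simultaneous_conjugator (map_tuple fst (in_tuple ps))
    (map_tuple snd (in_tuple ps)) x <->
    forall p, p \in ps -> conjg (braid_of_word p.1) x = braid_of_word p.2.
  split=> [H p|H i]; last by rewrite !tnth_map; apply: H; apply: mem_tnth.
  move=> /(@tnthP _ _ (in_tuple ps)) [i ->].
  by have := H i; rewrite !tnth_map.
case=> -[x|] -> /=; first by move=> /conjP gx; split=> // _; exists (braid_of_word x).
by move=> no_x; split=> // -[x /conjP gx]; case: no_x; exists x.
Qed.

Lemma eq_data_nat a b : eq_data (encode_nat a) (encode_nat b) = (a == b).
Proof. by elim: a b => [|a IH] [|b] //=; rewrite IH. Qed.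

Lemma reduction_program_correct Y Y' c d j k g h :
  2 <= n.-1 -> j < n.-1 -> ~~ Y j -> k < n.-1 -> ~~ Y' k ->
  solves_simultaneous_conjugacy n oracle ->
  computes oracle (reduction_program Y Y' c d j k)
    (Node (encode_word g) (encode_word h))
    (encode_bool `[< double_coset Y Y' (braid_of_word (loaded c d g))
                                       (braid_of_word (loaded c d h)) >]).
Proof.
move=> N2 jN jY kN kY solves.
rewrite /computes; set s0 := update _ _ _; set out := encode_bool _.
suff: runs oracle (reduction_program Y Y' c d j k) s0 (fun s => s 0 = out) by [].
set G := loaded c d g; set G' := loaded c d h.
apply/runs_seq; apply: (@runs_load_word _ _ _ _ _ g) => // s1 s1_1 s1_2 s1z.
apply/runs_seq; apply: (@runs_load_word _ _ _ _ _ h) => //.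
  by rewrite /= s1z.
move=> s2 s2_3 s2_4 s2z.
apply/runs_seq/runs_assign/runs_seq.
apply: (@runs_append_conjugates _ _ _ (inv_word G) (cut_twists n Y)) => //.
  by rewrite update_neq // s2z.
move=> s3 s3_6 s3z; apply/runs_seq/runs_assign/runs_seq.
apply: (@runs_append_conjugates _ _ _ (inv_word G') (cut_twists n Y)) => //.
  by rewrite update_neq // s3z // update_neq.
move=> s4 s4_7 s4z; apply/runs_seq/runs_query/runs_seq/runs_assign/runs_seq.
have s4_6 : s4 6 = encode_seq (@encode_word n)
    [seq p.2 | p <- conjugation_instance Y Y' G G'].
  rewrite s4z // update_neq // s3_6 /conjugation_instance map_cat -!map_comp.
  by rewrite inv_wordK (map_id (cut_twists n Y)).
have {}s4_7 : s4 7 = encode_seq (@encode_word n)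
    [seq p.1 | p <- conjugation_instance Y Y' G G'].
  rewrite s4_7 /conjugation_instance map_cat -!map_comp.
  by rewrite inv_wordK (map_id (cut_twists n Y)).
set s5 := update _ 16 _.
have s5_9 : s5 9 = oracle (Node (s4 7) (s4 6)) by [].
have s5z z : z != 9 -> z != 16 -> s5 z = s4 z by move=> z9 z16; rewrite /s5 !update_neq.
rewrite s4_7 s4_6 in s5_9.
have instP := oracle_instance (conjugation_instance Y Y' G G') solves.
rewrite -s5_9 in instP.
have cosetP := double_coset_reduction G G' N2 jN jY kN kY.
(* [Leaf] is the code of the negative answer; the loop is then skipped and variable 16 keeps its
   initial value, the code of [false]. *)
have [s5L|s5L] := pselect (s5 9 = Leaf).
  apply: runs_while_stop => //; apply: runs_assign.
  rewrite update_eq /out asboolF // => /cosetP [/instP //].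
apply: runs_while_step => //.
apply/runs_seq/runs_assign/runs_seq/runs_assign/runs_seq.
have s5G z : z < 5 -> z != 0 -> s5 z = s2 z.
  case: z => [|[|[|[|[|z]]]]] // _ _;
    by rewrite s5z // s4z // update_neq // s3z // update_neq.
apply: (@runs_count_index _ _ _ _ _ _ G 0 0) => //.
- by rewrite !update_neq // s5G // s2z.
- by rewrite !update_neq // s5G // s2z.
move=> s6 s6_14 s6_15 s6z; apply/runs_seq.
apply: (@runs_count_index _ _ _ _ _ _ G'
  (crossing_index true j k G) (crossing_index false j k G)) => //.
- by rewrite s6z; [rewrite !update_neq // s5G|left|..].
- by rewrite s6z; [rewrite !update_neq // s5G|left|..].
move=> s7 s7_15 s7_14 s7z.
apply/runs_seq/runs_assign/runs_assign/runs_while_stop; first by [].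
apply: runs_assign; rewrite update_eq /= update_neq // update_eq s7_14 s7_15 eq_data_nat.
rewrite /out; congr encode_bool; apply/eqP/asboolP => [e|/cosetP [_]].
  apply/cosetP; split; first exact/instP.
  by rewrite /same_index e addnC.
by rewrite /same_index => ->; rewrite addnC.
Qed.
End ReductionProgram.

(** * Reduction to standard parabolic subgroups, and conclusion *)

Local Open Scope group_scope.
Local Open Scope classical_set_scope.

Local Open Scope group_scope.
Lemma braid_of_loaded n (c d g : word n) : braid_of_word (loaded c d g) =
  braid_of_word c * braid_of_word g * (braid_of_word d)^-1.
Proof.
by rewrite /loaded braid_of_word_inv !braid_of_word_cat !braid_of_word_inv
  !invgM !invgK.
Qed.

Definition letters n (X : {set 'I_n.-1}) : pred nat :=
  fun k => [exists i in X, val i == k].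

Lemma lettersE n (X : {set 'I_n.-1}) (i : 'I_n.-1) : letters X (val i) = (i \in X).
Proof.
apply/existsP/idP => [[k /andP[kX /eqP /val_inj <-]] //|iX].
by exists i; rewrite iX eqxx.
Qed.

Lemma generated_sigma n (X : {set 'I_n.-1}) :
  generated [set @sigma n i | i in [set` X]] = [set a | supported (letters X) a].
Proof.
apply/seteqP; split.
  apply: smallest_sub.
    split=> [|a b /asboolP sa /asboolP sb]; apply/asboolP; first exact: supported1.
    exact/supportedM/supportedV.
  move=> _ [i /= iX <-]; rewrite -ev_ord; apply: supported_ev.
  by rewrite /= lettersE iX.
move=> a /= sa H [[H1 Hdiv] XH].
have {}H1 : H 1 by move/asboolP: H1.
have {}Hdiv x y : H x -> H y -> H (x / y).
  by move=> Hx Hy; apply/asboolP/Hdiv; apply/asboolP.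
have HV x : H x -> H x^-1 by move=> Hx; rewrite -div1g; apply: Hdiv.
move: a sa; apply: supported_ind => //.
  move=> x y Hx Hy; rewrite -[y]invgK.
  exact/Hdiv/HV.
move=> i iN iX; apply: XH; exists (Ordinal iN); last by rewrite -ev_ord.
by rewrite /= -lettersE.
Qed.

(** The origin of the words [loaded c d g]: conjugate subgroups are replaced by standard ones at the
    price of changing the representatives. *)
Lemma in_double_coset_conj n (P Q : set (braid n)) (c d x y : braid n) :
  in_double_coset [set z ^ c | z in P] [set z ^ d | z in Q] x y <->
  in_double_coset P Q (c * x * d^-1) (c * y * d^-1).
Proof.
split=> [[_ [_ [[a Pa <-] [b Qb <-] ->]]]|[a [b [Pa Qb e]]]].
  by exists a, b; split=> //; rewrite !conjgE !mulgA mulgV mul1g mulgK.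
exists (a ^ c), (b ^ d); split; [by exists a|by exists b|].
have -> : y = c^-1 * (c * y * d^-1) * d by rewrite !mulgA mulVg mul1g mulgVK.
by rewrite e !conjgE !mulgA.
Qed.

Lemma letters_full n (X : {set 'I_n.-1}) (a : braid n) :
  ~ (exists2 j, j < n.-1 & ~~ letters X j) -> supported (letters X) a.
Proof.
move=> full; exists (repr a); last by rewrite braid_of_word_repr.
apply/allP => l _; have [//|lX] := boolP (letters X (val l.1)).
by case: full; exact: (ex_intro2 _ _ (val l.1) (ltn_ord _) lX).
Qed.

Lemma computes_const oracle p e d :
  (forall s, eval s e = d) -> computes oracle (Assign 0 e) p d.
Proof.
move=> ed; rewrite /computes.
by eexists; [exact: exec_assign | rewrite updateE eqxx ed].
Qed.

Theorem theorem3p3 (n : nat) (hn : 3 <= n) (A B : set (braid n))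
    (hA : parabolic A) (hB : parabolic B) :
  double_coset_reduces_to_simultaneous_conjugacy A B.
Proof.
have [P [c [[X ->] ->]]] := hA; have [Q [d [[X' ->] ->]]] := hB.
rewrite !generated_sigma; have N2 : 2 <= n.-1 by lia.
have cosetP (g h : braid n) : in_double_coset [set x ^ c | x in supported (letters X)]
    [set x ^ d | x in supported (letters X')] g h <->
  double_coset (letters X) (letters X') (c * g * d^-1) (c * h * d^-1).
  by rewrite in_double_coset_conj.
have always : (forall g h : braid n, double_coset (letters X) (letters X') g h) ->
    double_coset_reduces_to_simultaneous_conjugacy
      [set x ^ c | x in supported (letters X)]
      [set x ^ d | x in supported (letters X')].
  move=> all_gh; exists (Assign 0 (Const (encode_bool true))) => o _ g h.
  by apply: computes_const => s; rewrite asboolT //; apply/cosetP.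
have [[j jN jX]|fullX] := pselect (exists2 j, j < n.-1 & ~~ letters X j); last first.
  apply: always => g h; exists (h * g^-1), 1.
  by split; [exact: (letters_full _ fullX)|exact: supported1|rewrite mulg1 mulgVK].
have [[k kN kX]|fullX'] := pselect (exists2 j, j < n.-1 & ~~ letters X' j); last first.
  apply: always => g h; exists 1, (g^-1 * h).
  by split; [exact: supported1|exact: (letters_full _ fullX')|rewrite mul1g mulVKg].
(* Words for the conjugating braids and one missing letter on each side are built into the program,
   which may depend on A and B. *)
exists (reduction_program (letters X) (letters X') (repr c) (repr d) j k) => o so g h.
have := reduction_program_correct (repr c) (repr d) g h N2 jN jX kN kX so.
rewrite !braid_of_loaded !braid_of_word_repr.
by have -> := propext (cosetP (braid_of_word g) (braid_of_word h)).
Qed.
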